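(* Let $\mathcal{D}$ be a triangulated category and $(\mathcal{D}^{\leq 0},\mathcal{D}^{\geq 1})$ a bounded $t$-structure on $\mathcal{D}$ whose heart $\mathcal{H}$ is contravariantly finite in $\mathcal{D}$. Then the mutually inverse bijections $\theta$ and $\mu$ between ICE sequences in $\mathcal{H}$ and homology-determined preaisles in $\mathcal{D}$ restrict to bijections between (1) the set of contravariantly finite full ICE sequences in $\mathcal{H}$, and (2) the set of two-sided bounded homology-determined aisles in $\mathcal{D}$. Moreover, if $(\mathcal{D}^{\leq 0},\mathcal{D}^{\geq 1})$ is an algebraic $t$-structure on $\mathcal{D}$, then the set (2) coincides with (3) the set of bounded $t$-structures on $\mathcal{D}$ whose aisles are homology-determined (a $t$-structure being identified with its aisle).
   Context: All subcategories are full, additive and closed under isomorphisms. For a $t$-structure $(\mathcal{D}^{\leq 0},\mathcal{D}^{\geq 1})$ put $\mathcal{D}^{\leq n}=\mathcal{D}^{\leq 0}[-n]$, $\mathcal{D}^{\geq n+1}=\mathcal{D}^{\geq 1}[-n]$; the heart is the abelian category $\mathcal{H}=\mathcal{D}^{\leq 0}\cap\mathcal{D}^{\geq 0}$, $H^0\colon\mathcal{D}\to\mathcal{H}$ is the associated cohomological functor, $H^kX=H^0(X[k])$. It is bounded if $\bigcup_{n}\mathcal{D}^{\leq n}=\mathcal{D}=\bigcup_{n}\mathcal{D}^{\geq n}$; a bounded $t$-structure is algebraic if its heart is an abelian length category with finitely many simple objects up to isomorphism. An aisle in $\mathcal{D}$ is the first component $\mathcal{U}$ of some $t$-structure $(\mathcal{U},\mathcal{V})$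 on $\mathcal{D}$; it is two-sided bounded if there are integers $m\leq n$ with $\mathcal{D}^{\leq m}\subseteq\mathcal{U}\subseteq\mathcal{D}^{\leq n}$. A preaisle is a subcategory $\mathcal{U}$ closed under extensions with $\mathcal{U}[1]\subseteq\mathcal{U}$. A subcategory $\mathcal{U}$ of $\mathcal{D}$ is homology-determined (with respect to the fixed $t$-structure) if for every $X\in\mathcal{D}$: $X\in\mathcal{U}$ if and only if $H^kX\in\mathcal{U}[k]$ for all $k\in\mathbb{Z}$. A subcategory $\mathcal{B}$ of $\mathcal{C}$ is contravariantly finite in $\mathcal{C}$ if for every $X\in\mathcal{C}$ there is a morphism $f\colon B\to X$ with $B\in\mathcal{B}$ through which every morphism $B'\to X$ with $B'\in\mathcal{B}$ factors. ICE sequences: let $\mathcal{A}$ be an abelian category. A subcategory $\mathcal{C}$ of $\mathcal{A}$ is ICE-closed if it is closed under extensions and, for every morphism $f$ between objects of $\mathcal{C}$, the image and cokernel of $f$ in $\mathcal{A}$ belong to $\mathcal{C}$. For $\mathcal{C}$ ICE-closed, put $\alpha\mathcal{C}=\{A\in\mathcal{C}\mid \ker f\in\mathcal{C}\text{ for every morphism } f\colon C\to A\text{ with }C\in\mathcal{C}\}$; this is a wide subcategory of $\mathcal{A}$ (closed under extensions, kernels and cokernels), hence itself an abelian category. A torsion class in an abelian category is a subcategory closed under extensions and quotients in that category. A sequence $\{\mathcal{C}(k)\}_{k\in\mathbb{Z}}$ of subcategories of $\mathcal{A}$ is an ICE sequence if for every $k$, $\mathcal{C}(k)$ is an ICE-closed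 subcategory of $\mathcal{A}$ and $\mathcal{C}(k+1)$ is a torsion class in $\alpha(\mathcal{C}(k))$. It is contravariantly finite if each $\mathcal{C}(k)$ is contravariantly finite in $\mathcal{A}$; it is full if there are integers $m\leq n$ with $\mathcal{C}(m)=\mathcal{A}$ and $\mathcal{C}(n)=0$. The maps: for an ICE sequence $\mathcal{C}=\{\mathcal{C}(k)\}_{k}$ in $\mathcal{H}$, $\theta(\mathcal{C})=\{X\in\mathcal{D}\mid H^kX\in\mathcal{C}(k)\ \forall k\in\mathbb{Z}\}$; for a homology-determined preaisle $\mathcal{U}$, $\mu(\mathcal{U})=\{H^k\mathcal{U}\}_{k\in\mathbb{Z}}$, where $H^k\mathcal{U}$ consists of the objects isomorphic to $H^kX$, $X\in\mathcal{U}$. These are mutually inverse bijections between ICE sequences in $\mathcal{H}$ and homology-determined preaisles in $\mathcal{D}$. *)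

(* Defs.v *)
From mathcomp Require Import all_boot all_algebra.
From mathcomp Require Import boolp classical_sets functions.

Set Implicit Arguments.
Unset Strict Implicit.
Unset Printing Implicit Defensive.

Import GRing.Theory.
Local Open Scope classical_set_scope.
Local Open Scope ring_scope.

Reserved Notation "g \oc f" (at level 40, left associativity).

(** * Preadditive categories *)

Record preaddCat := PreaddCat {
  obj :> Type;
  hom : obj -> obj -> zmodType;
  idm : forall X, hom X X;
  compm : forall X Y Z, hom Y Z -> hom X Y -> hom X Z;
  comp1m : forall X Y (f : hom X Y), compm (idm Y) f = f;
  compm1 : forall X Y (f : hom X Y), compm f (idm X) = f;
  compmA : forall W X Y Z (h : hom Y Z) (g : hom X Y) (f : hom W X),
    compm h (compm g f) = compm (compm h g) f;
  compmDl : forall X Y Z (g g' : hom Y Z) (f : hom X Y),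
    compm (g + g') f = compm g f + compm g' f;
  compmDr : forall X Y Z (g : hom Y Z) (f f' : hom X Y),
    compm g (f + f') = compm g f + compm g f' }.

Arguments hom {p}.
Arguments idm {p}.
Notation "g \oc f" := (compm g f).

Section Preadditive.
Variable A : preaddCat.
Implicit Types (X Y Z K S : A) (B : set A).

Definition is_iso X Y (f : hom X Y) :=
  exists g : hom Y X, g \oc f = idm X /\ f \oc g = idm Y.

Definition isomorphic X Y := exists f : hom X Y, is_iso f.

Definition mono X Y (f : hom X Y) :=
  forall W (u v : hom W X), f \oc u = f \oc v -> u = v.

Definition epi X Y (f : hom X Y) :=
  forall Z (u v : hom Y Z), u \oc f = v \oc f -> u = v.

Definition is_zero X := idm X = 0.

Definition is_biproduct X Y S :=
  exists (i : hom X S) (j : hom Y S) (p : hom S X) (q : hom S Y),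
    [/\ p \oc i = idm X, q \oc j = idm Y, p \oc j = 0, q \oc i = 0
      & i \oc p + j \oc q = idm S].

Definition is_kernel X Y (f : hom X Y) K (k : hom K X) :=
  f \oc k = 0 /\
  forall W (u : hom W X), f \oc u = 0 -> exists! v : hom W K, k \oc v = u.

Definition is_cokernel X Y (f : hom X Y) Z (c : hom Y Z) :=
  c \oc f = 0 /\
  forall W (u : hom Y W), u \oc f = 0 -> exists! v : hom Z W, v \oc c = u.

(* The image of a morphism is the kernel of its cokernel. *)
Definition is_image X Y (f : hom X Y) K (k : hom K Y) :=
  exists Z (c : hom Y Z), is_cokernel f c /\ is_kernel c k.

Definition short_exact X Y Z (f : hom X Y) (g : hom Y Z) :=
  is_kernel g f /\ is_cokernel f g.

Definition additive_cat :=
  (exists Z, is_zero Z) /\ forall X Y, exists S, is_biproduct X Y S.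

Definition abelian_cat :=
  [/\ additive_cat,
      forall X Y (f : hom X Y), exists K (k : hom K X), is_kernel f k,
      forall X Y (f : hom X Y), exists Z (c : hom Y Z), is_cokernel f c,
      forall X Y (f : hom X Y), mono f ->
        exists Z (c : hom Y Z), is_kernel c f
    & forall X Y (f : hom X Y), epi f ->
        exists K (k : hom K X), is_cokernel k f].

Definition simple_obj S :=
  ~ is_zero S /\ forall X (f : hom X S), mono f -> f = 0 \/ is_iso f.

(* Existence of a finite composition series. *)
Inductive finite_length : A -> Prop :=
| FiniteLength0 X : is_zero X -> finite_length X
| FiniteLengthS X Y S (f : hom X Y) (g : hom Y S) :
    finite_length X -> simple_obj S -> short_exact f g -> finite_length Y.

Definition length_cat := abelian_cat /\ forall X, finite_length X.

Definition finitely_many_simples :=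
  exists n (s : 'I_n -> A), forall S, simple_obj S ->
    exists i, isomorphic S (s i).

(* Full subcategories are sets of objects; all those considered are additive
   and closed under isomorphisms. *)
Definition subcat B :=
  [/\ forall X, is_zero X -> B X,
      forall X Y S, is_biproduct X Y S -> B X -> B Y -> B S
    & forall X Y, isomorphic X Y -> B X -> B Y].

Definition ext_closed B :=
  forall X Y Z (f : hom X Y) (g : hom Y Z),
    short_exact f g -> B X -> B Z -> B Y.

Definition quotient_closed B :=
  forall X Y (f : hom X Y), epi f -> B X -> B Y.

Definition contrav_finite B :=
  forall X, exists Y (f : hom Y X), B Y /\
    forall Z (g : hom Z X), B Z -> exists h : hom Z Y, g = f \oc h.

Definition torsion_class B := [/\ subcat B, ext_closed B & quotient_closed B].

Definition ICE_closed B :=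
  [/\ subcat B,
      ext_closed B,
      forall X Y (f : hom X Y), B X -> B Y ->
        forall K (k : hom K Y), is_image f k -> B K
    & forall X Y (f : hom X Y), B X -> B Y ->
        forall Z (c : hom Y Z), is_cokernel f c -> B Z].

Definition alpha B : set A :=
  [set X | B X /\ forall Y (f : hom Y X), B Y ->
     forall K (k : hom K Y), is_kernel f k -> B K].

Definition fullsub B : preaddCat :=
  @PreaddCat {X | B X} (fun x y => hom (sval x) (sval y))
    (fun x => idm (sval x))
    (fun x y z => @compm A (sval x) (sval y) (sval z))
    (fun x y => @comp1m A (sval x) (sval y))
    (fun x y => @compm1 A (sval x) (sval y))
    (fun w x y z => @compmA A (sval w) (sval x) (sval y) (sval z))
    (fun x y z => @compmDl A (sval x) (sval y) (sval z))
    (fun x y z => @compmDr A (sval x) (sval y) (sval z)).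

(* [B'], as a set of objects of the full subcategory on [B]. *)
Definition within B (B' : set A) : set (fullsub B) :=
  [set x | B' (sval x)].

End Preadditive.

Section ICESequences.
Variable A : preaddCat.
Implicit Types (C : int -> set A).

Definition ICE_seq C :=
  forall k, [/\ ICE_closed (C k), C (k + 1) `<=` alpha (C k)
    & torsion_class (@within A (alpha (C k)) (C (k + 1)))].

Definition contrav_finite_seq C :=
  forall k, contrav_finite (C k).

Definition full_seq C :=
  exists m n : int, [/\ m <= n, C m = setT & C n = @is_zero A].

End ICESequences.

(** * Triangulated categories *)

(* The suspension [susp] is an autoequivalence: it is fully faithful, and
   [desusp] chooses a preimage of each object up to isomorphism, so that
   [desusp] is the object part of a quasi-inverse. *)
Record triCat := TriCat {
  tcat :> preaddCat;
  tcat_additive : additive_cat tcat;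
  susp : tcat -> tcat;
  suspm : forall X Y : tcat, {additive hom X Y -> hom (susp X) (susp Y)};
  suspm1 : forall X, suspm X X (idm X) = idm (susp X);
  suspmM : forall X Y Z (g : hom Y Z) (f : hom X Y),
    suspm X Z (g \oc f) = suspm Y Z g \oc suspm X Y f;
  suspm_bij : forall X Y, bijective (suspm X Y);
  desusp : tcat -> tcat;
  desuspK : forall X, isomorphic (susp (desusp X)) X;
  dist : forall X Y Z, hom X Y -> hom Y Z -> hom Z (susp X) -> Prop;
  dist_iso : forall X Y Z (f : hom X Y) (g : hom Y Z) (h : hom Z (susp X))
      X' Y' Z' (f' : hom X' Y') (g' : hom Y' Z') (h' : hom Z' (susp X'))
      (a : hom X X') (b : hom Y Y') (c : hom Z Z'),
    is_iso a -> is_iso b -> is_iso c ->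
    b \oc f = f' \oc a -> c \oc g = g' \oc b -> suspm X X' a \oc h = h' \oc c ->
    dist f g h -> dist f' g' h';
  dist_id : forall X O, is_zero O ->
    dist (idm X) (0 : hom X O) (0 : hom O (susp X));
  dist_ex : forall X Y (f : hom X Y), exists Z (g : hom Y Z) h, dist f g h;
  dist_rot : forall X Y Z (f : hom X Y) (g : hom Y Z) (h : hom Z (susp X)),
    dist f g h <-> dist g h (- suspm X Y f);
  dist_map : forall X Y Z (f : hom X Y) (g : hom Y Z) (h : hom Z (susp X))
      X' Y' Z' (f' : hom X' Y') (g' : hom Y' Z') (h' : hom Z' (susp X'))
      (a : hom X X') (b : hom Y Y'),
    dist f g h -> dist f' g' h' -> b \oc f = f' \oc a ->
    exists c : hom Z Z', c \oc g = g' \oc b /\ suspm X X' a \oc h = h' \oc c;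
  dist_oct : forall X Y Z X' Y' Z' (f : hom X Y) (g : hom Y Z)
      (f' : hom Y Z') (f'' : hom Z' (susp X))
      (g' : hom Z X') (g'' : hom X' (susp Y))
      (h' : hom Z Y') (h'' : hom Y' (susp X)),
    dist f f' f'' -> dist g g' g'' -> dist (g \oc f) h' h'' ->
    exists (u : hom Z' Y') (v : hom Y' X'),
      [/\ dist u v (suspm Y Z' f' \oc g''),
          u \oc f' = h' \oc g, h'' \oc u = f'',
          v \oc h' = g' & g'' \oc v = suspm X Y f \oc h''] }.

Arguments susp {t}.
Arguments suspm {t X Y}.
Arguments desusp {t}.

Section Shift.
Variable D : triCat.

(* X[n] *)
Definition shift (X : D) (n : int) : D :=
  match n with
  | Posz n => iter n susp X
  | Negz n => iter n.+1 desusp X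
  end.

(* U[n], closed under isomorphisms *)
Definition shift_set (U : set D) (n : int) : set D :=
  [set X | exists2 Y, U Y & isomorphic X (shift Y n)].

End Shift.

(** * t-structures *)

(* [aisle] is D^{<= 0} and [coaisle] is D^{>= 1}. *)
Record tStructure (D : triCat) := TStructure {
  aisle : set D;
  coaisle : set D;
  aisle_subcat : subcat aisle;
  coaisle_subcat : subcat coaisle;
  aisle_shift : shift_set aisle 1 `<=` aisle;
  coaisle_shift : shift_set coaisle (-1) `<=` coaisle;
  aisle_orth : forall X Y (f : hom X Y), aisle X -> coaisle Y -> f = 0;
  tri_ex : forall X, exists U V, exists (f : hom U X) (g : hom X V) h,
    [/\ aisle U, coaisle V & dist f g h] }.

Section Truncations.
Variables (D : triCat) (T : tStructure D).

(* D^{<= n} and D^{>= n} *)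
Definition tle (n : int) : set D := shift_set (aisle T) (- n).
Definition tge (n : int) : set D := shift_set (coaisle T) (1 - n).

Definition bounded := \bigcup_n tle n = setT /\ \bigcup_n tge n = setT.

End Truncations.

Section TStructureTheory.
Variables (D : triCat) (T : tStructure D).
Implicit Types (X Y Z : D) (U : set D).

Definition heart_set : set D := tle T 0 `&` tge T 0.
Definition heart : preaddCat := fullsub heart_set.

Definition algebraic :=
  [/\ bounded T, length_cat heart & finitely_many_simples heart].

Definition tau_le0 X : D := sval (cid (tri_ex T X)).
Definition tau_ge1 X : D := sval (cid (svalP (cid (tri_ex T X)))).
Definition tau_ge0 X : D := shift (tau_ge1 (shift X (-1))) 1.

Lemma tauP X : exists (f : hom (tau_le0 X) X) (g : hom X (tau_ge1 X)) h,
  [/\ aisle T (tau_le0 X), coaisle T (tau_ge1 X) & dist f g h].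
Proof. exact: svalP (cid (svalP (cid (tri_ex T X)))). Qed.

Lemma comp0m (A : preaddCat) (X Y Z : A) (f : hom X Y) :
  (0 : hom Y Z) \oc f = 0.
Proof. by apply: (addrI (0 \oc f)); rewrite -compmDl !addr0. Qed.

Lemma compm0 (A : preaddCat) (X Y Z : A) (f : hom Y Z) :
  f \oc (0 : hom X Y) = 0.
Proof. by apply: (addrI (f \oc 0)); rewrite -compmDr !addr0. Qed.

Lemma isomorphic_refl (A : preaddCat) (X : A) : isomorphic X X.
Proof. by exists (idm X), (idm X); rewrite comp1m. Qed.

Lemma isomorphic_sym (A : preaddCat) (X Y : A) :
  isomorphic X Y -> isomorphic Y X.
Proof. by move=> [f [g [gf fg]]]; exists g, f. Qed.

Lemma dist_weak_cokernel X Y Z W (f : hom X Y) (g : hom Y Z)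
    (h : hom Z (susp X)) (u : hom Y W) :
  dist f g h -> u \oc f = 0 -> exists v : hom Z W, u = v \oc g.
Proof.
move=> fgh uf0; have [[O O0] _] := tcat_additive D.
have dW : dist (0 : hom O W) (idm W) (0 : hom W (susp O)).
  apply/dist_rot; rewrite raddf0 oppr0; apply: dist_id.
  by rewrite /is_zero -suspm1 O0 raddf0.
have [v [vg _]] := dist_map (a := 0 : hom X O) (b := u) fgh dW
  (etrans uf0 (esym (compm0 _ _))).
by exists v; rewrite vg comp1m.
Qed.

Lemma dist_zero_iso X Y Z (f : hom X Y) (g : hom Y Z) (h : hom Z (susp X)) :
  dist f g h -> is_zero Z -> is_iso f.
Proof.
move=> fgh Z0.
have fepi W (u : hom Y W) : u \oc f = 0 -> u = 0.
  move=> /(dist_weak_cokernel fgh) [v ->].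
  by rewrite -[v]compm1 Z0 compm0 comp0m.
have [r rE] : exists r, idm (susp X) = r \oc - suspm f.
  move/dist_rot/dist_rot: fgh => fgh; apply: (dist_weak_cokernel fgh).
  by rewrite comp1m -[h]compm1 Z0 compm0.
have [k kK Kk] := suspm_bij Y X.
have kf : (- k r) \oc f = idm X.
  apply: (bij_inj (suspm_bij X X)).
  rewrite suspmM raddfN Kk suspm1 rE.
  apply/eqP; rewrite -subr_eq0; apply/eqP.
  have -> : - r \oc suspm f = r \oc - suspm f; last by rewrite subrr.
  apply: (addrI (r \oc suspm f)).
  by rewrite -compmDl -compmDr !subrr comp0m compm0.
exists (- k r); split=> //; apply/eqP; rewrite -subr_eq0; apply/eqP.
apply: fepi; apply: (addIr (idm Y \oc f)); rewrite -compmDl subrK add0r.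
by rewrite -compmA kf compm1 comp1m.
Qed.

Lemma aisle_dist X Y Z (f : hom X Y) (g : hom Y Z) (h : hom Z (susp X)) :
  dist f g h -> aisle T Y -> aisle T (susp X) -> aisle T Z.
Proof.
move=> fgh UY USX; have [a [b [c [UZ VZ abc]]]] := tauP Z.
have [v bE] : exists v, b = v \oc h.
  move/dist_rot: fgh => fgh; apply: (dist_weak_cokernel fgh).
  exact: aisle_orth UY VZ.
have b0 : b = 0 by rewrite bE (aisle_orth v USX VZ) comp0m.
have [w wE] : exists w, idm (tau_ge1 Z) = w \oc c.
  apply: (dist_weak_cokernel (proj1 (dist_rot _ _ _) abc)).
  by rewrite b0 compm0.
have USZ : aisle T (susp (tau_le0 Z)).
  by apply: aisle_shift; exists (tau_le0 Z) => //; exact: isomorphic_refl.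
have V0 : is_zero (tau_ge1 Z).
  by rewrite /is_zero wE (aisle_orth w USZ VZ) comp0m.
have [_ _ isoU] := aisle_subcat T.
by apply: isoU UZ; exists a; exact: dist_zero_iso abc V0.
Qed.

Lemma aisle_susp X : aisle T X -> aisle T (susp X).
Proof.
by move=> UX; apply: aisle_shift; exists X => //; exact: isomorphic_refl.
Qed.

Lemma tau_ge0_aisle X : aisle T X -> aisle T (tau_ge0 X).
Proof.
move=> UX; have [f [g [h [UA VB fgh]]]] := tauP (shift X (-1)).
have [_ _ isoU] := aisle_subcat T.
move/dist_rot/dist_rot/dist_rot/aisle_dist: fgh; apply; last first.
  by do 2!apply: aisle_susp.
by apply: isoU UX; apply: isomorphic_sym; exact: desuspK.
Qed.

Lemma H0_subproof X : heart_set (tau_ge0 (tau_le0 X)).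
Proof.
have [_ [_ [_ [UX _ _]]]] := tauP X.
have [_ [_ [_ [_ VX _]]]] := tauP (shift (tau_le0 X) (-1)).
split; last by exists (tau_ge1 (shift (tau_le0 X) (-1))) => //;
  exact: isomorphic_refl.
by exists (tau_ge0 (tau_le0 X)); [exact: tau_ge0_aisle|exact: isomorphic_refl].
Qed.

(* The object part of the cohomological functor H^0, as the composite of
   truncations; the truncation triangles are picked by choice. *)
Definition H0 X : heart := exist _ (tau_ge0 (tau_le0 X)) (H0_subproof X).
Definition Hk (k : int) X : heart := H0 (shift X k).

Definition two_sided_bounded U :=
  exists m n : int, [/\ m <= n, tle T m `<=` U & U `<=` tle T n].

Definition homology_determined U :=
  subcat U /\ forall X, U X <-> forall k, shift_set U k (sval (Hk k X)).

Definition theta (C : int -> set heart) : set D :=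
  [set X | forall k, C k (Hk k X)].

Definition mu U : int -> set heart :=
  fun k => [set A | exists2 X, U X & isomorphic A (Hk k X)].

Definition cf_full_ICE_seqs : set (int -> set heart) :=
  [set C | [/\ ICE_seq C, contrav_finite_seq C & full_seq C]].

Definition bounded_hd_aisles : set (set D) :=
  [set U | [/\ exists T' : tStructure D, aisle T' = U,
               two_sided_bounded U & homology_determined U]].

(* A t-structure is identified with its aisle. *)
Definition hd_bounded_tStructures : set (set D) :=
  [set U | exists T' : tStructure D,
     [/\ aisle T' = U, bounded T' & homology_determined (aisle T')]].

End TStructureTheory.

Arguments theta {D} T C.
Arguments mu {D} T U.
Arguments cf_full_ICE_seqs {D} T.
Arguments bounded_hd_aisles {D} T.
Arguments hd_bounded_tStructures {D} T.

(* Main.v *)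
Require Import Defs.
From mathcomp Require Import all_boot all_order all_algebra.
From mathcomp Require Import boolp classical_sets functions.
From mathcomp Require Import zify.
(* all_algebra shadows the name hom. *)
Import Defs.

Set Implicit Arguments.
Unset Strict Implicit.
Unset Printing Implicit Defensive.

Import GRing.Theory.
Local Open Scope classical_set_scope.
Local Open Scope ring_scope.

(* For a homology-determined preaisle U put C(k) = {A | A[-k] in U}.  The
   kernel K and the cokernel Q of a morphism of the heart are the cohomology
   objects of its cone, so closure of U under cones yields the ICE conditions.

   Conversely an object X of D^{<=n} lies in theta(C) if and only if its
   truncation X' in D^{<=n-1} does and its top cohomology lies in C(n).
   Closure of theta(C) under extensions follows by induction on cohomological
   length: an extension of Z by X is filtered by X', A[-n], Z', B[-n], and the
   two middle layers are exchanged by taking the kernel and the cokernel of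
   the induced morphism from the top cohomology of Z' to A.

   When the heart is contravariantly finite in D, the same layers show that
   theta(C) meets each D^{<=n} in a contravariantly finite subcategory, since
   the objects of P * Q are approximated by approximations from P and Q.  A
   contravariantly finite preaisle is an aisle as soon as idempotents split:
   the coreflection of X is the image of an idempotent of a cover of X.
   Idempotents split in D because they do in the heart and splitting passes
   through truncation triangles. *)

(** * Kernels, cokernels and idempotents in preadditive categories *)

Section Preadditive.
Variable A : preaddCat.
Implicit Types (X Y Z W K : A) (B : set A).

Lemma compmNl X Y Z (g : hom Y Z) (f : hom X Y) : (- g) \oc f = - (g \oc f).
Proof. by apply/eqP; rewrite -addr_eq0 -compmDl addNr comp0m. Qed.

Lemma compmNr X Y Z (g : hom Y Z) (f : hom X Y) : g \oc (- f) = - (g \oc f).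
Proof. by apply/eqP; rewrite -addr_eq0 -compmDr addNr compm0. Qed.

Lemma compmBl X Y Z (g g' : hom Y Z) (f : hom X Y) :
  (g - g') \oc f = g \oc f - g' \oc f.
Proof. by rewrite compmDl compmNl. Qed.

Lemma compmBr X Y Z (g : hom Y Z) (f f' : hom X Y) :
  g \oc (f - f') = g \oc f - g \oc f'.
Proof. by rewrite compmDr compmNr. Qed.

Lemma is_iso_id X : is_iso (idm X).
Proof. by exists (idm X); rewrite comp1m. Qed.

Lemma is_iso_comp X Y Z (g : hom Y Z) (f : hom X Y) :
  is_iso g -> is_iso f -> is_iso (g \oc f).
Proof.
move=> [g' [g'g gg']] [f' [f'f ff']]; exists (f' \oc g'); split.
  by rewrite compmA -(compmA f') g'g compm1.
by rewrite compmA -(compmA g) ff' compm1.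
Qed.

Lemma isomorphic_trans Y X Z :
  isomorphic X Y -> isomorphic Y Z -> isomorphic X Z.
Proof. by move=> [f fi] [g gi]; exists (g \oc f); apply: is_iso_comp. Qed.

Definition hom0 X Y := forall f : hom X Y, f = 0.

Lemma hom0_iso X X' Y Y' :
  isomorphic X X' -> isomorphic Y Y' -> hom0 X Y -> hom0 X' Y'.
Proof.
move=> [a [a' [_ aa']]] [b [b' [_ bb']]] h0 f.
rewrite -[f]compm1 -aa' -[f]comp1m -bb' compmA -(compmA _ f) -!(compmA b).
by rewrite (compmA b' f a) (h0 (b' \oc f \oc a)) comp0m compm0.
Qed.

Lemma is_zero_hom0l X Y : is_zero X -> hom0 X Y.
Proof. by move=> X0 f; rewrite -[f]compm1 X0 compm0. Qed.

Lemma is_zero_hom0r X Y : is_zero Y -> hom0 X Y.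
Proof. by move=> Y0 f; rewrite -[f]comp1m Y0 comp0m. Qed.

Lemma is_zero_iso X Y : isomorphic X Y -> is_zero X -> is_zero Y.
Proof.
move=> [f [g [_ fg]]] X0; rewrite /is_zero -fg -[f]compm1 X0.
by rewrite compm0 comp0m.
Qed.

(* [1 + n] is inverted by [1 - n]. *)
Lemma unipotent_iso X (u : hom X X) :
  (u - idm X) \oc (u - idm X) = 0 -> is_iso u.
Proof.
rewrite -[X in is_iso X](subrK (idm X)).
move: (u - idm X) => n nn; rewrite addrC.
exists (idm X - n).
by split; rewrite !(compmDl, compmDr, compmNl, compmNr, comp1m, compm1) nn
  ?oppr0 addr0 ?subrK ?addrK.
Qed.

Lemma iso_from_comp X Y (f : hom X Y) (g : hom Y X) :
  is_iso (g \oc f) -> is_iso (f \oc g) -> is_iso f.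
Proof.
move=> [a [a1 _]] [b [_ b2]].
have fab : a \oc g = g \oc b.
  by rewrite -[LHS]compm1 -b2 -(compmA f) 2!compmA -(compmA a) a1 comp1m.
exists (a \oc g); split; first by rewrite -compmA.
by rewrite fab compmA.
Qed.

Lemma kernel_iso X Y (f : hom X Y) K (k : hom K X) K' (k' : hom K' X) :
  is_kernel f k -> is_kernel f k' ->
  exists2 a : hom K K', is_iso a & k' \oc a = k.
Proof.
move=> [fk uk] [fk' uk'].
have [a [ka _]] := uk' _ _ fk; have [b [kb _]] := uk _ _ fk'.
exists a => //; exists b; split.
  have [c [_ cu]] := uk _ _ fk.
  by rewrite -(cu (b \oc a)) ?(cu (idm K)) ?compm1 // compmA kb.
have [c [_ cu]] := uk' _ _ fk'.
by rewrite -(cu (a \oc b)) ?(cu (idm K')) ?compm1 // compmA ka.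
Qed.

Lemma cokernel_iso X Y (f : hom X Y) Q (c : hom Y Q) Q' (c' : hom Y Q') :
  is_cokernel f c -> is_cokernel f c' ->
  exists2 a : hom Q Q', is_iso a & a \oc c = c'.
Proof.
move=> [fk uk] [fk' uk'].
have [a [ka _]] := uk _ _ fk'; have [b [kb _]] := uk' _ _ fk.
exists a => //; exists b; split.
  have [d [_ cu]] := uk _ _ fk.
  by rewrite -(cu (b \oc a)) ?(cu (idm Q)) ?comp1m // -compmA ka.
have [d [_ cu]] := uk' _ _ fk'.
by rewrite -(cu (a \oc b)) ?(cu (idm Q')) ?comp1m // -compmA kb.
Qed.

Lemma is_kernel_postcomp X Y Z (f : hom X Y) (b : hom Y Z) K (k : hom K X) :
  is_iso b -> is_kernel f k -> is_kernel (b \oc f) k.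
Proof.
move=> [b' [b'b _]] [fk uk]; split; first by rewrite -compmA fk compm0.
by move=> W u bfu; apply: uk; rewrite -[f]comp1m -b'b -!compmA (compmA b) bfu compm0.
Qed.

Lemma is_kernel_mono X Y Z (f : hom X Y) (g : hom Y Z) K (k : hom K X) :
  mono g -> is_kernel f k -> is_kernel (g \oc f) k.
Proof.
move=> gm [fk uk]; split; first by rewrite -compmA fk compm0.
by move=> W u; rewrite -compmA => gfu; apply: uk; apply: gm; rewrite gfu compm0.
Qed.

Lemma kernel_mono X Y (f : hom X Y) K (k : hom K X) : is_kernel f k -> mono k.
Proof.
move=> [fk uk] W u v kuv.
have [w [_ wu]] := uk _ (k \oc v) (etrans (compmA _ _ _)
  (etrans (congr1 (fun x => x \oc v) fk) (comp0m _ _))).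
by rewrite -(wu u) ?(wu v).
Qed.

Lemma cokernel_epi X Y (f : hom X Y) Q (c : hom Y Q) : is_cokernel f c -> epi c.
Proof.
move=> [fk uk] W u v kuv.
have [w [_ wu]] := uk _ (v \oc c) (etrans (esym (compmA _ _ _))
  (etrans (congr1 (fun x => v \oc x) fk) (compm0 _ _))).
by rewrite -(wu u) ?(wu v).
Qed.

Lemma biproduct_sym X Y S :
  is_biproduct X Y S -> is_biproduct Y X S.
Proof.
by move=> [i [j [p [q [pi qj pj qi E]]]]]; exists j, i, q, p; split; rewrite 1?addrC.
Qed.

(** Sandwiching the complementary idempotent [i' \oc q'] between [q] and [i'], or between [q'] and
    [i], gives the two mixed relations. *)
Lemma split_biproduct X Y Z (i : hom Y X) (q : hom X Y)
    (i' : hom Z X) (q' : hom X Z) :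
  q \oc i = idm Y -> q' \oc i' = idm Z -> i' \oc q' = idm X - i \oc q ->
  is_biproduct Y Z X.
Proof.
move=> qi qi' E; exists i, i', q, q'; split=> //; last by rewrite E addrC subrK.
  transitivity (q \oc (i' \oc q') \oc i'); first by rewrite -!compmA qi' compm1.
  by rewrite E compmBr compm1 compmA qi comp1m subrr comp0m.
transitivity (q' \oc ((i' \oc q') \oc i)); first by rewrite !compmA qi' comp1m.
by rewrite E compmBl comp1m -compmA qi compm1 subrr compm0.
Qed.

(** A kernel [k] is a monomorphism, so [f] and [k \oc f] have the same kernel. *)
Lemma alpha_kernel B Y Z (g : hom Y Z) K (k : hom K Y) :
  alpha B Y -> alpha B Z -> is_kernel g k -> alpha B K.
Proof.
move=> [BY kY] [BZ kZ] kk; split; first exact: kZ kk.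
move=> W f BW K' k' kk'; apply: (kY W (k \oc f) BW K' k').
exact: is_kernel_mono (kernel_mono kk) kk'.
Qed.

Definition iso_closed (P : set A) := forall X Y, isomorphic X Y -> P X -> P Y.

Definition splits X := forall e : hom X X, e \oc e = e ->
  exists Y (i : hom Y X) (q : hom X Y), q \oc i = idm Y /\ i \oc q = e.

Lemma splits_iso X Y : isomorphic X Y -> splits X -> splits Y.
Proof.
move=> [f [g [gf fg]]] sX e ee.
have [|Z [i [q [qi iq]]]] := sX (g \oc e \oc f).
  by rewrite !compmA -(compmA _ f) fg compm1 -(compmA g e e) ee.
exists Z, (f \oc i), (q \oc g); split.
  by rewrite compmA -(compmA _ g) gf compm1.
by rewrite compmA -(compmA f) iq !compmA fg comp1m -compmA fg compm1.
Qed.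

(* The idempotents e and p = i q satisfy e p e = e and p e p = p. *)
Lemma split_idem_perturb X Y (e : hom X X) (i : hom Y X) (q : hom X Y) :
  e \oc e = e -> q \oc i = idm Y ->
  (e - i \oc q) \oc (e - i \oc q) = 0 ->
  exists (i' : hom Y X) (q' : hom X Y), q' \oc i' = idm Y /\ i' \oc q' = e.
Proof.
move=> ee qi; have [p pE] : exists p, p = i \oc q by exists (i \oc q).
rewrite -pE.
have pp : p \oc p = p by rewrite pE compmA -(compmA i) qi compm1.
rewrite compmBl !compmBr ee pp opprB => dd.
have epE : e \oc p + p \oc e = e + p.
  by apply/esym/eqP; rewrite -subr_eq0 opprD addrACA dd.
have pep : p \oc e \oc p = p.
  apply: (addrI (p \oc e \oc p)).
  transitivity (p \oc (e \oc p + p \oc e) \oc p).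
    by rewrite compmDr compmDl !compmA pp -!(compmA _ p p) pp.
  by rewrite epE compmDr compmDl !pp.
have epe : e \oc p \oc e = e.
  apply: (addrI (e \oc p \oc e)).
  transitivity (e \oc (e \oc p + p \oc e) \oc e).
    by rewrite compmDr compmDl !compmA ee -!(compmA _ e e) ee.
  by rewrite epE compmDr compmDl !ee addrC.
exists (e \oc i), (q \oc e); split; last by rewrite compmA -(compmA e) -pE.
have qpi : q \oc p \oc i = idm Y by rewrite pE !compmA qi comp1m qi.
rewrite compmA -(compmA q) ee.
transitivity (q \oc (p \oc e \oc p) \oc i); last by rewrite pep.
by rewrite pE -!compmA qi compm1 !compmA qi comp1m.
Qed.

End Preadditive.

(** * Distinguished triangles and the octahedral axiom *)

Section Triangulated.
Variable D : triCat.
Implicit Types (X Y Z W A B I K Q : D).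

Lemma suspm_inj X Y : injective (@suspm D X Y).
Proof. exact: bij_inj (suspm_bij X Y). Qed.

Lemma suspm_surj X Y (g : hom (susp X) (susp Y)) : exists f, suspm f = g.
Proof. by have [k _ gK] := suspm_bij X Y; exists (k g). Qed.

Lemma isomorphic_susp X Y : isomorphic (susp X) (susp Y) <-> isomorphic X Y.
Proof.
split=> [[f [g [gf fg]]]|[f [g [gf fg]]]].
  have [f' f'E] := suspm_surj f; have [g' g'E] := suspm_surj g.
  exists f', g'; split; apply: suspm_inj; rewrite suspmM suspm1 f'E g'E //.
by exists (suspm f), (suspm g); rewrite -!suspmM gf fg !suspm1.
Qed.

Lemma desusp_susp X : isomorphic (desusp (susp X)) X.
Proof. by apply/isomorphic_susp; apply: desuspK. Qed.

Lemma isomorphic_desusp X Y : isomorphic X Y -> isomorphic (desusp X) (desusp Y).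
Proof.
move=> XY; apply/isomorphic_susp; apply: isomorphic_trans (desuspK X) _.
by apply: isomorphic_trans XY _; apply: isomorphic_sym; apply: desuspK.
Qed.

Lemma hom0_susp X Y : hom0 (susp X) (susp Y) <-> hom0 X Y.
Proof.
split=> h0 f; first by apply: suspm_inj; rewrite (h0 (suspm f)) raddf0.
by have [g <-] := suspm_surj f; rewrite (h0 g) raddf0.
Qed.

Lemma is_zero_susp X : is_zero (susp X) <-> is_zero X.
Proof.
rewrite /is_zero; split=> [X0|X0]; last by rewrite -suspm1 X0 raddf0.
by apply: suspm_inj; rewrite suspm1 raddf0.
Qed.

Lemma dist_comp0 X Y Z (f : hom X Y) (g : hom Y Z) (h : hom Z (susp X)) :
  dist f g h -> g \oc f = 0.
Proof.
move=> fgh; have [[O O0] _] := tcat_additive D.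
have [c [cE _]] := dist_map (a := idm X) (b := f) (dist_id X O0) fgh erefl.
by rewrite -cE compm0.
Qed.

Lemma dist_weak_kernel X Y Z W (f : hom X Y) (g : hom Y Z)
    (h : hom Z (susp X)) (u : hom W Y) :
  dist f g h -> g \oc u = 0 -> exists v : hom W X, u = f \oc v.
Proof.
move=> fgh gu0; have [[O O0] _] := tcat_additive D.
have [c [_ cE]] := dist_map (a := u) (b := 0 : hom O Z)
  (proj1 (dist_rot _ _ _) (dist_id W O0)) (proj1 (dist_rot _ _ _) fgh)
  (etrans (compm0 _ _) (esym gu0)).
have [v vE] := suspm_surj c; exists v; apply: suspm_inj.
apply: oppr_inj; move: cE.
by rewrite suspm1 compmNr compm1 compmNl -vE suspmM.
Qed.

(** Since the suspension is full, the third morphism is minus a suspended one, so the rotation can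
    be undone. *)
Lemma dist_unrot Y Z X (g : hom Y Z) (h : hom Z (susp X))
    (s : hom (susp X) (susp Y)) :
  dist g h s -> exists2 f : hom X Y, s = - suspm f & dist f g h.
Proof.
move=> ghs; have [f fE] := suspm_surj (- s).
have sE : s = - suspm f by rewrite fE opprK.
by exists f => //; apply/dist_rot; rewrite -sE.
Qed.

(** Desuspend the cone; as [desusp] inverts [susp] only up to isomorphism, the triangle is
    transported before it is rotated back. *)
Lemma dist_cocone Y Z (g : hom Y Z) :
  exists X (f : hom X Y) (h : hom Z (susp X)), dist f g h.
Proof.
have [W [a [b gab]]] := dist_ex g.
have [i [j [ji ij]]] := desuspK W.
have iI : is_iso i by exists j.
have jI : is_iso j by exists i.
have: dist g (j \oc a) (b \oc i).
  apply: dist_iso (is_iso_id _) (is_iso_id _) jI _ _ _ gab.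
  - by rewrite compm1 comp1m.
  - by rewrite compm1.
  - by rewrite suspm1 comp1m -compmA ij compm1.
by move=> /dist_unrot[f _ fgh]; exists (desusp W), f, (j \oc a).
Qed.

Lemma dist_ex3 X Z (h : hom Z (susp X)) :
  exists Y (f : hom X Y) (g : hom Y Z), dist f g h.
Proof.
have [Y [g [s ghs]]] := dist_cocone h.
by have [f _ fgh] := dist_unrot ghs; exists Y, f, g.
Qed.

Lemma dist_map_mid X Y Z (f : hom X Y) (g : hom Y Z) (h : hom Z (susp X))
    X' Y' Z' (f' : hom X' Y') (g' : hom Y' Z') (h' : hom Z' (susp X'))
    (a : hom X X') (c : hom Z Z') :
  dist f g h -> dist f' g' h' -> suspm a \oc h = h' \oc c ->
  exists b : hom Y Y', b \oc f = f' \oc a /\ g' \oc b = c \oc g.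
Proof.
move=> d d' E.
have [b' [b1 b2]] := dist_map (proj1 (dist_rot _ _ _) (proj1 (dist_rot _ _ _) d))
  (proj1 (dist_rot _ _ _) (proj1 (dist_rot _ _ _) d')) E.
have [b bE] := suspm_surj b'; exists b.
move: b1 b2; rewrite -bE !compmNr !compmNl -!suspmM.
by move=> /oppr_inj /suspm_inj -> /oppr_inj /suspm_inj ->.
Qed.

(** A filler [c'] in the opposite direction exists by the axioms. Each composite of [c] and [c']
    differs from an invertible endomorphism, the identity, by a morphism of square zero. *)
Lemma dist_five X Y Z (f : hom X Y) (g : hom Y Z) (h : hom Z (susp X))
    X' Y' Z' (f' : hom X' Y') (g' : hom Y' Z') (h' : hom Z' (susp X'))
    (a : hom X X') (b : hom Y Y') (c : hom Z Z') :
  dist f g h -> dist f' g' h' -> is_iso a -> is_iso b ->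
  b \oc f = f' \oc a -> c \oc g = g' \oc b -> suspm a \oc h = h' \oc c ->
  is_iso c.
Proof.
have nil U V W (p : hom U V) (q : hom V W) (r : hom W (susp U)) (n : hom W W) :
    dist p q r -> n \oc q = q -> r \oc n = r -> is_iso n.
  move=> pqr nq rn; apply: unipotent_iso.
  have [|s sE] := dist_weak_cokernel (u := n - idm W) (proj1 (dist_rot _ _ _) pqr).
    by rewrite compmBl nq comp1m subrr.
  by rewrite {1}sE -compmA compmBr rn compm1 subrr compm0.
move=> d d' [a' [a'a aa']] [b' [b'b bb']] bf cg ah.
have [|c' [c'g a'h]] := dist_map (a := a') (b := b') d' d.
  rewrite -[LHS]compm1 -aa' !compmA -(compmA b') -bf.
  by rewrite (compmA b') b'b comp1m.
apply: (@iso_from_comp _ _ _ c c').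
  apply: (nil _ _ _ _ _ _ _ d).
    by rewrite -compmA cg compmA c'g -compmA b'b compm1.
  by rewrite compmA -a'h -compmA -ah compmA -suspmM a'a suspm1 comp1m.
apply: (nil _ _ _ _ _ _ _ d').
  by rewrite -compmA c'g compmA cg -compmA bb' compm1.
by rewrite compmA -ah -compmA -a'h compmA -suspmM aa' suspm1 comp1m.
Qed.

(** Triangles with their morphisms forgotten: this suffices to handle filtrations and is invariant
    under isomorphism of the three objects. *)
Definition tri X Y Z :=
  exists (f : hom X Y) (g : hom Y Z) (h : hom Z (susp X)), dist f g h.

Lemma tri_iso X X' Y Y' Z Z' : isomorphic X X' -> isomorphic Y Y' ->
  isomorphic Z Z' -> tri X Y Z -> tri X' Y' Z'.
Proof.
move=> [a [a' [a1 a2]]] [b [b' [b1 b2]]] [c [c' [c1 c2]]] [f [g [h fgh]]].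
exists (b \oc f \oc a'), (c \oc g \oc b'), (suspm a \oc h \oc c').
apply: dist_iso fgh; first by exists a'; split; eassumption.
- by exists b'; split; eassumption.
- by exists c'; split; eassumption.
- by rewrite -!compmA a1 compm1.
- by rewrite -!compmA b1 compm1.
- by rewrite -!compmA c1 compm1.
Qed.

Lemma tri_rot X Y Z : tri X Y Z <-> tri Y Z (susp X).
Proof.
split=> [[f [g [h fgh]]]|[g [h [s ghs]]]].
  by exists g, h, (- suspm f); exact: (proj1 (dist_rot _ _ _) fgh).
by have [f _ fgh] := dist_unrot ghs; exists f, g, h.
Qed.

Lemma tri_susp X Y Z : tri X Y Z <-> tri (susp X) (susp Y) (susp Z).
Proof. by rewrite 3!tri_rot. Qed.

Lemma tri_rotl X Y Z : tri X Y Z -> tri (desusp Z) X Y.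
Proof.
move=> xyz; apply/tri_rot; apply: tri_iso xyz; try exact: isomorphic_refl.
by apply: isomorphic_sym; apply: desuspK.
Qed.

Lemma tri_id X O : is_zero O -> tri X X O.
Proof. by move=> O0; exists (idm X), 0, 0; apply: dist_id. Qed.

Lemma tri_id0 X O : is_zero O -> tri O X X.
Proof. by move=> O0; apply/tri_rot/tri_id/is_zero_susp. Qed.

Lemma tri_zero3 X Y Z : tri X Y Z -> is_zero Z -> isomorphic X Y.
Proof. by move=> [f [g [h fgh]]] Z0; exists f; apply: dist_zero_iso fgh Z0. Qed.

Lemma tri_zero1 X Y Z : tri X Y Z -> is_zero X -> isomorphic Y Z.
Proof. by move=> /tri_rot xyz X0; apply: tri_zero3 xyz _; apply/is_zero_susp. Qed.

(** The octahedral axiom for filtrations: [W] has layers [X], [Z], [V], and the last two are grouped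
    into [Q]. *)
Lemma tri_assocr X Y Z W V : tri X Y Z -> tri Y W V ->
  exists Q, tri X W Q /\ tri Z Q V.
Proof.
move=> [f [f' [f'' df]]] [g [g' [g'' dg]]].
have [Q [h' [h'' dh]]] := dist_ex (g \oc f).
have [u [v [duv _ _ _ _]]] := dist_oct df dg dh.
exists Q; split; first by exists (g \oc f), h', h''.
by exists u, v, (suspm f' \oc g'').
Qed.

(** The opposite regrouping, obtained from [tri_assocr] by rotating the triangles. *)
Lemma tri_assocl X Y Z A B : tri X Y Z -> tri A Z B ->
  exists Q, tri X Q A /\ tri Q Y B.
Proof.
move=> /tri_rot YZX /tri_rot ZBA; have [R [YBR XRA]] := tri_assocr YZX ZBA.
exists (desusp R); split.
  apply/tri_susp; apply: tri_iso XRA; try exact: isomorphic_refl.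
  by apply: isomorphic_sym; apply: desuspK.
apply/tri_rot; apply: tri_iso YBR; try exact: isomorphic_refl.
by apply: isomorphic_sym; apply: desuspK.
Qed.

Lemma tri_hom0r W X Y Z : tri X Y Z -> hom0 W X -> hom0 W Z -> hom0 W Y.
Proof.
move=> [f [g [h fgh]]] WX WZ u.
have [|v ->] := dist_weak_kernel (u := u) fgh; first exact: WZ.
by rewrite (WX v) compm0.
Qed.

Lemma tri_hom0l W X Y Z : tri X Y Z -> hom0 X W -> hom0 Z W -> hom0 Y W.
Proof.
move=> [f [g [h fgh]]] WX WZ u.
have [|v ->] := dist_weak_cokernel (u := u) fgh; first exact: WX.
by rewrite (WZ v) comp0m.
Qed.

(** The inclusion [i] is split, so the connecting morphism of its cone vanishes; hence the morphism
    [v] from the cone to [Y] induced by [q] has inverse [g \oc j]. *)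
Lemma biproduct_tri X Y S : is_biproduct X Y S -> tri X S Y.
Proof.
move=> [i [j [p [q [pi qj pj qi ipjq]]]]].
have [Z [g [h igh]]] := dist_ex i.
have h0 : h = 0.
  move/dist_rot/dist_rot/dist_comp0: igh; rewrite compmNl => /eqP.
  rewrite oppr_eq0 => /eqP ih.
  by rewrite -[h]comp1m -suspm1 -pi suspmM -compmA ih compm0.
have [v vE] := dist_weak_cokernel igh qi.
have gepi W (u : hom Z W) : u \oc g = 0 -> u = 0.
  move=> ug; have [w ->] := dist_weak_cokernel (proj1 (dist_rot _ _ _) igh) ug.
  by rewrite h0 compm0.
have vI : isomorphic Z Y.
  exists v, (g \oc j); rewrite compmA -vE qj; split=> //.
  apply/eqP; rewrite -subr_eq0; apply/eqP/gepi.
  rewrite compmBl comp1m -!compmA -vE.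
  have -> : j \oc q = idm S - i \oc p by rewrite -ipjq addrC addKr.
  by rewrite compmBr compm1 compmA (dist_comp0 igh) comp0m subr0 subrr.
apply: (tri_iso (isomorphic_refl X) (isomorphic_refl S) vI).
by exists i, g, h.
Qed.

Lemma zero_ex : exists O : D, is_zero O.
Proof. by have [] := tcat_additive D. Qed.

(** The connecting morphism vanishes, so [g] has a section [s]. The octahedron on [g \oc s], whose
    cone is zero, identifies the cone of [s] with [X]. *)
Lemma tri_split X Y Z : tri X Y Z -> hom0 Z (susp X) -> tri Z Y X.
Proof.
move=> [f [g [h d]]] h0; have [O O0] := zero_ex.
have [|s sE] := dist_weak_kernel (u := idm Z) (proj1 (dist_rot _ _ _) d).
  by rewrite compm1; apply: h0.
have [C [c [t ds]]] := dist_ex s.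
have d1 := dist_id Z O0; rewrite sE in d1.
have [u [v [duv _ _ _ _]]] := dist_oct ds (proj1 (dist_rot _ _ _) d) d1.
have XC : isomorphic X C.
  apply: (@tri_zero3 X C O) => //; apply: (proj2 (tri_rot _ _ _)).
  by exists u, v, (suspm c \oc - suspm f).
apply: tri_iso (isomorphic_refl _) (isomorphic_refl _) (isomorphic_sym XC) _.
by exists s, c, t.
Qed.

(** The octahedron on [j \oc p]: the cone of [p] is [susp K] and that of [j] is [Q]. For objects of
    the heart, kernel and cokernel thus become the two layers of the cone. *)
Lemma cone_filtration K A I B Q Z (k : hom K A) (p : hom A I) r
    (j : hom I B) (c : hom B Q) s (g : hom B Z) h :
  dist k p r -> dist j c s -> dist (j \oc p) g h -> tri (susp K) Z Q.
Proof.
move=> dk dj d.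
have [u [v [duv _ _ _ _]]] := dist_oct (proj1 (dist_rot _ _ _) dk) dj d.
by exists u, v, (suspm r \oc s).
Qed.

(** * Shifts *)

Lemma susp_shift X n : isomorphic (susp (shift X n)) (shift X (n + 1)).
Proof.
case: n => n /=; first by rewrite addn1; apply: isomorphic_refl.
have -> : Negz n + 1 = - n%:Z by lia.
case: n => [|n]; exact: desuspK.
Qed.

Lemma desusp_shift X n : isomorphic (desusp (shift X n)) (shift X (n - 1)).
Proof.
apply: isomorphic_trans (desusp_susp _); apply: isomorphic_desusp.
by apply: isomorphic_sym; have := susp_shift X (n - 1); rewrite subrK.
Qed.

(** With an equivalence as its step, one argument covers positive and negative shifts. *)
Lemma int_ind1 (P : int -> Prop) : P 0 -> (forall n, P n <-> P (n + 1)) ->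
  forall n, P n.
Proof.
move=> P0 PS n; elim/int_ind: n => // n.
  by move/PS; rewrite -addn1.
move=> Pn; apply/PS; move: Pn; congr P; lia.
Qed.

Lemma isomorphic_shift X Y n :
  isomorphic X Y -> isomorphic (shift X n) (shift Y n).
Proof.
move=> XY; elim/int_ind1: n => // n; split=> h.
  apply: isomorphic_trans (susp_shift Y n).
  apply: isomorphic_trans (isomorphic_sym (susp_shift X n)) _.
  by apply/isomorphic_susp.
apply/isomorphic_susp; apply: isomorphic_trans (susp_shift X n) _.
by apply: isomorphic_trans h _; apply/isomorphic_sym/susp_shift.
Qed.

Lemma shiftD X m n : isomorphic (shift (shift X m) n) (shift X (m + n)).
Proof.
elim/int_ind1: n => [|n]; first by rewrite addr0; apply: isomorphic_refl.
rewrite addrA; split=> h.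
  apply: isomorphic_trans (susp_shift _ _).
  by apply: isomorphic_trans (isomorphic_sym (susp_shift _ _)) _; apply/isomorphic_susp.
apply/isomorphic_susp; apply: isomorphic_trans (susp_shift _ _) _.
by apply: isomorphic_trans h _; apply/isomorphic_sym/susp_shift.
Qed.

Lemma shiftNK X n : isomorphic (shift (shift X (- n)) n) X.
Proof. by have := shiftD X (- n) n; rewrite addNr. Qed.

Lemma shiftKN X n : isomorphic (shift (shift X n) (- n)) X.
Proof. by have := shiftD X n (- n); rewrite subrr. Qed.

Lemma shift_susp X n : isomorphic (shift (susp X) n) (shift X (n + 1)).
Proof. by rewrite addrC; apply: (shiftD X 1 n). Qed.

Lemma isomorphic_shiftE X Y n :
  isomorphic X (shift Y n) <-> isomorphic (shift X (- n)) Y.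
Proof.
split=> [/(isomorphic_shift (- n)) h|/(isomorphic_shift n) h].
  exact: isomorphic_trans h (shiftKN _ _).
exact: isomorphic_trans (isomorphic_sym (shiftNK _ _)) h.
Qed.

Lemma tri_shift X Y Z n : tri X Y Z <-> tri (shift X n) (shift Y n) (shift Z n).
Proof.
elim/int_ind1: n => // n.
suff -> : tri (shift X n) (shift Y n) (shift Z n) <->
  tri (shift X (n + 1)) (shift Y (n + 1)) (shift Z (n + 1)) by [].
rewrite tri_susp; split; apply: tri_iso; try exact: susp_shift;
  exact/isomorphic_sym/susp_shift.
Qed.

Lemma hom0_shift X Y n : hom0 (shift X n) (shift Y n) <-> hom0 X Y.
Proof.
elim/int_ind1: n => // n.
suff -> : hom0 (shift X n) (shift Y n) <->
  hom0 (shift X (n + 1)) (shift Y (n + 1)) by [].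
rewrite -hom0_susp; split; apply: hom0_iso; try exact: susp_shift;
    exact/isomorphic_sym/susp_shift.
Qed.

Lemma is_zero_shift X n : is_zero (shift X n) <-> is_zero X.
Proof.
elim/int_ind1: n => // n.
suff -> : is_zero (shift X n) <-> is_zero (shift X (n + 1)) by [].
rewrite -is_zero_susp; split; apply: is_zero_iso; first exact: susp_shift.
exact/isomorphic_sym/susp_shift.
Qed.

(** * Approximations *)

Lemma contrav_finite_susp (P : set D) : iso_closed P ->
  contrav_finite P <-> contrav_finite [set X | P (susp X)].
Proof.
move=> Piso; split=> cP X.
  have [B [f [PB fP]]] := cP (susp X).
  have [i [j [ji ij]]] := desuspK B.
  have [f' f'E] := suspm_surj (f \oc i).
  exists (desusp B), f'; split.
    by apply: Piso PB; exists j, i.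
  move=> Z g PZ; have [h hE] := fP _ (suspm g) PZ.
  have [h' h'E] := suspm_surj (j \oc h); exists h'; apply: suspm_inj.
  by rewrite suspmM f'E h'E compmA -(compmA f) ij compm1.
have [B [f [PB fP]]] := cP (desusp X).
have [i [j [ji ij]]] := desuspK X.
exists (susp B), (i \oc suspm f); split=> // Z g PZ.
have [a [b [ba ab]]] := desuspK Z.
have [g' g'E] := suspm_surj (j \oc g \oc a).
have [|h hE] := fP _ g'.
  by apply: Piso PZ; exists b, a.
exists (suspm h \oc b); rewrite compmA -(compmA i) -suspmM -hE g'E.
by rewrite !compmA ij comp1m -compmA ab compm1.
Qed.

Lemma contrav_finite_shift (P : set D) n : iso_closed P ->
  contrav_finite P -> contrav_finite [set X | P (shift X n)].
Proof.
move=> Piso cP; elim/int_ind1: n => // n.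
rewrite [X in _ <-> X](_ : _ <->
  contrav_finite [set X | P (shift (susp X) n)]).
  apply: (@contrav_finite_susp [set X | P (shift X n)]) => X Y XY.
  by apply: Piso; apply: isomorphic_shift.
suff -> : [set X | P (shift X (n + 1))] = [set X | P (shift (susp X) n)] by [].
apply/funext => X; apply/propext; split; apply: Piso.
  exact/isomorphic_sym/shift_susp.
exact: shift_susp.
Qed.

Definition star (P Q : set D) : set D :=
  [set Y | exists X Z, [/\ P X, Q Z & tri X Y Z]].

(** Cover [X] by [a] from [P], cover the cone [W] of [a] by [w] from [Q], and pull the triangle back
    along [w]: the middle term [E] covers [X]. *)
Lemma contrav_finite_star (P Q : set D) :
  contrav_finite P -> contrav_finite Q -> contrav_finite (star P Q).
Proof.
move=> cP cQ X.
have [A [a [PA aP]]] := cP X.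
have [W [g [h agh]]] := dist_ex a.
have [B [w [QB wQ]]] := cQ W.
have [E [f' [g' d']]] := dist_ex3 (h \oc w).
have [|phi [phif wg]] := dist_map_mid (a := idm A) (c := w) d' agh.
  by rewrite suspm1 comp1m.
rewrite compm1 in phif.
exists E, phi; split; first by exists A, B; split=> //; exists f', g', (h \oc w).
move=> Y e [X' [Z' [PX' QZ' [i [p [r ipr]]]]]].
have [s sE] := aP _ (e \oc i) PX'.
have [|t [tE1 tE2]] := dist_map (a := s) (b := e) ipr agh; first by [].
have [u uE] := wQ _ t QZ'.
have [psi psiE] : exists psi, u \oc p = g' \oc psi.
  apply: (dist_weak_kernel (proj1 (dist_rot _ _ _) d')).
  rewrite -compmA (compmA w) -uE tE1 compmA.
  by rewrite (dist_comp0 (proj1 (dist_rot _ _ _) agh)) comp0m.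
(* The error [e - phi \oc psi] dies in [W], hence factors through [A], and [A] maps to [E] by
   [f']. *)
have [|v vE] := dist_weak_kernel (u := e - phi \oc psi) agh.
  by rewrite compmBr compmA wg -compmA -psiE compmA -uE tE1 subrr.
exists (psi + f' \oc v); rewrite compmDr compmA phif -vE.
by rewrite addrC subrK.
Qed.

End Triangulated.

(** * Truncation triangles in all degrees *)

Section Truncation.
Variables (D : triCat) (T : tStructure D).
Implicit Types (X Y Z W : D) (m n k : int).

Lemma aisle_iso : iso_closed (aisle T).
Proof. by have [] := aisle_subcat T. Qed.

Lemma coaisle_iso : iso_closed (coaisle T).
Proof. by have [] := coaisle_subcat T. Qed.

Lemma tleE n X : tle T n X <-> aisle T (shift X n).
Proof.
split=> [[Y aY XY]|aX]; last first.
  by exists (shift X n) => //; apply/isomorphic_sym/shiftKN.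
move/isomorphic_shiftE: XY; rewrite opprK => /isomorphic_sym XY.
exact: aisle_iso XY aY.
Qed.

Lemma tgeE n X : tge T n X <-> coaisle T (shift X (n - 1)).
Proof.
split=> [[Y aY XY]|aX]; last first.
  exists (shift X (n - 1)) => //; rewrite -[1 - n]opprB.
  exact/isomorphic_sym/shiftKN.
move/isomorphic_shiftE: XY; rewrite opprB => /isomorphic_sym XY.
exact: coaisle_iso XY aY.
Qed.

Lemma tle_iso n : iso_closed (tle T n).
Proof.
by move=> X Y XY; rewrite !tleE; apply: aisle_iso; apply: isomorphic_shift.
Qed.

Lemma tge_iso n : iso_closed (tge T n).
Proof.
by move=> X Y XY; rewrite !tgeE; apply: coaisle_iso; apply: isomorphic_shift.
Qed.

Lemma tle_shift n k X : tle T n (shift X k) <-> tle T (k + n) X.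
Proof.
rewrite !tleE; split; apply: aisle_iso; first exact: shiftD.
exact/isomorphic_sym/shiftD.
Qed.

Lemma tge_shift n k X : tge T n (shift X k) <-> tge T (k + n) X.
Proof.
rewrite !tgeE -addrA; split; apply: coaisle_iso; first exact: shiftD.
exact/isomorphic_sym/shiftD.
Qed.

Lemma tle_susp n X : tle T n (susp X) <-> tle T (n + 1) X.
Proof. by rewrite addrC; apply: (tle_shift n 1). Qed.

Lemma tge_susp n X : tge T n (susp X) <-> tge T (n + 1) X.
Proof. by rewrite addrC; apply: (tge_shift n 1). Qed.

Lemma tle_zero n X : is_zero X -> tle T n X.
Proof.
move=> X0; apply/tleE; have [a0 _ _] := aisle_subcat T.
by apply: a0; apply/is_zero_shift.
Qed.

Lemma tge_zero n X : is_zero X -> tge T n X.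
Proof.
move=> X0; apply/tgeE; have [a0 _ _] := coaisle_subcat T.
by apply: a0; apply/is_zero_shift.
Qed.

Lemma tle_le m n X : (m <= n)%R -> tle T m X -> tle T n X.
Proof.
move=> mn; have -> : n = m + `|n - m|%N%:Z by lia.
elim: `|n - m|%N => [|k IH]; first by rewrite addr0.
move=> /IH; rewrite !tleE => aX.
have -> : m + k.+1%:Z = m + k%:Z + 1 by lia.
by apply: aisle_iso (susp_shift _ _) _; apply: aisle_susp.
Qed.

Lemma tge_le m n X : (m <= n)%R -> tge T n X -> tge T m X.
Proof.
move=> mn; have -> : m = n - `|n - m|%N%:Z by lia.
elim: `|n - m|%N => [|k IH]; first by rewrite subr0.
move=> /IH; rewrite !tgeE => aX.
have -> : n - k.+1%:Z - 1 = n - k%:Z - 1 - 1 by lia.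
apply: coaisle_iso (desusp_shift _ _) _; apply: coaisle_shift.
by exists (shift X (n - k%:Z - 1)) => //; apply: isomorphic_refl.
Qed.

Lemma tle_tge_hom0 m n X Y : (m < n)%R -> tle T m X -> tge T n Y -> hom0 X Y.
Proof.
move=> mn; have /tle_le mn1 : m <= n - 1 by lia.
move=> /mn1; rewrite tleE tgeE => aX aY.
by apply/(hom0_shift X Y (n - 1)) => f; apply: aisle_orth aX aY.
Qed.

Lemma truncation_orth n X Y (f : hom X Y) :
  tle T n X -> tge T (n + 1) Y -> f = 0.
Proof. by move=> aX bY; apply: (@tle_tge_hom0 n (n + 1)) aX bY f; lia. Qed.

Lemma truncation_susp_orth n X Y (f : hom (susp X) Y) :
  tle T n X -> tge T (n + 1) Y -> f = 0.
Proof.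
move=> aX; apply: truncation_orth; apply/tle_susp.
by apply: tle_le aX; lia.
Qed.

Lemma tle_tge_zero m n X : (m < n)%R -> tle T m X -> tge T n X -> is_zero X.
Proof. by move=> mn aX bX; apply: tle_tge_hom0 mn aX bX _. Qed.

Lemma truncation n X : exists L V, [/\ tri L X V, tle T n L & tge T (n + 1) V].
Proof.
have [L [V [f [g [h [aL bV d]]]]]] := tri_ex T (shift X n).
exists (shift L (- n)), (shift V (- n)); split.
- have : tri L (shift X n) V by exists f, g, h.
  rewrite (tri_shift _ _ _ (- n)); apply: tri_iso; try exact: isomorphic_refl.
  exact: shiftKN.
- by apply/tleE; apply: aisle_iso aL; apply/isomorphic_sym/shiftNK.
- apply/tgeE; rewrite addrK; apply: coaisle_iso bV.
  exact/isomorphic_sym/shiftNK.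
Qed.

(** The morphism from [X] to its truncation [V] vanishes, so the identity of [V] factors through
    [susp L], which is orthogonal to [V]. *)
Lemma tle_orth n X : (forall Y, tge T (n + 1) Y -> hom0 X Y) -> tle T n X.
Proof.
move=> X0; have [L [V [[f [g [h d]]] aL bV]]] := truncation n X.
apply: tle_iso (aL); apply: (tri_zero3 (Z := V)); first by exists f, g, h.
have [|v vE] := dist_weak_cokernel (u := idm V) (proj1 (dist_rot _ _ _) d).
  exact: X0.
by rewrite /is_zero vE (truncation_susp_orth v aL bV) comp0m.
Qed.

Lemma tge_orth n Y : (forall X, tle T n X -> hom0 X Y) -> tge T (n + 1) Y.
Proof.
move=> Y0; have [L [V [[f [g [h d]]] aL bV]]] := truncation n Y.
apply: tge_iso (bV); apply: isomorphic_sym.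
apply: (tri_zero1 (X := L)); first by exists f, g, h.
apply/is_zero_susp; rewrite /is_zero -suspm1.
have [|v vE] := dist_weak_kernel (u := suspm (idm L))
   (proj1 (dist_rot _ _ _) (proj1 (dist_rot _ _ _) d)).
  by rewrite compmNl -suspmM (Y0 L aL (f \oc idm L)) raddf0 oppr0.
by rewrite vE (truncation_susp_orth v aL bV) compm0.
Qed.

Lemma tle_ext n X Y Z : tri X Y Z -> tle T n X -> tle T n Z -> tle T n Y.
Proof.
move=> d aX aZ; apply: tle_orth => W bW.
have h0 V : tle T n V -> hom0 V W.
  by move=> aV; apply: (@tle_tge_hom0 n (n + 1)) aV bW; lia.
exact: tri_hom0l d (h0 _ aX) (h0 _ aZ).
Qed.

Lemma tge_ext n X Y Z : tri X Y Z -> tge T n X -> tge T n Z -> tge T n Y.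
Proof.
move=> d aX aZ; rewrite -(subrK 1 n); apply: tge_orth => W bW.
have h0 V : tge T n V -> hom0 W V.
  by move=> aV; apply: (@tle_tge_hom0 (n - 1) n) bW aV; lia.
exact: tri_hom0r d (h0 _ aX) (h0 _ aZ).
Qed.

Lemma tle_tri3 n X Y Z : tri X Y Z -> tle T (n + 1) X -> tle T n Y -> tle T n Z.
Proof. by move=> /tri_rot d aX aY; apply: tle_ext d aY _; apply/tle_susp. Qed.

Lemma tge_tri1 n X Y Z :
  tri X Y Z -> tge T (n + 1) Y -> tge T n Z -> tge T (n + 1) X.
Proof.
move=> /tri_rotl d bY bZ; apply: tge_ext d _ bY.
suff: tge T (n + 1) (shift Z (-1)) by [].
by apply/tge_shift; apply: tge_le bZ; lia.
Qed.

(** Lifts between [L] and [L'] exist by orthogonality. They are unique because the suspension of a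
    difference of two lifts factors through a morphism from [susp L1] to the coaisle part. *)
Lemma truncation_unique n L X V L' X' V' :
  tri L X V -> tri L' X' V' -> isomorphic X X' ->
  tle T n L -> tle T n L' -> tge T (n + 1) V -> tge T (n + 1) V' ->
  isomorphic L L' /\ isomorphic V V'.
Proof.
move=> d d' XX' aL aL' bV bV'.
have {d}[f [g [h d]]] := tri_iso (isomorphic_refl L) XX' (isomorphic_refl V) d.
move: d' => [f' [g' [h' d']]].
have lift M U (m : hom M X') (x : hom X' U) y L1 (m1 : hom L1 X') : dist m x y ->
    tle T n L1 -> tge T (n + 1) U -> exists a : hom L1 M, m \oc a = m1.
  move=> dm aL1 bU; have [|a aE] := dist_weak_kernel (u := m1) dm.
    exact: truncation_orth bU.
  by exists a.
have uniq M U (m : hom M X') (x : hom X' U) y L1 (a b : hom L1 M) : dist m x y ->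
    tle T n L1 -> tge T (n + 1) U -> m \oc a = m \oc b -> a = b.
  move=> dm aL1 bU mab; apply: suspm_inj; apply/eqP; rewrite -subr_eq0; apply/eqP.
  have [|v ->] := dist_weak_kernel (u := suspm a - suspm b)
      (proj1 (dist_rot _ _ _) (proj1 (dist_rot _ _ _) dm)).
    by rewrite compmBr !compmNl -!suspmM mab subrr.
  by rewrite (truncation_susp_orth v aL1 bU) compm0.
have [a aE] := lift _ _ _ _ _ _ f d' aL bV'.
have [b bE] := lift _ _ _ _ _ _ f' d aL' bV.
have aI : is_iso a.
  exists b; split.
    by apply: (uniq _ _ _ _ _ _ _ _ d aL bV); rewrite compm1 compmA bE.
  by apply: (uniq _ _ _ _ _ _ _ _ d' aL' bV'); rewrite compm1 compmA aE.
split; first by exists a.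
have E : idm X' \oc f = f' \oc a by rewrite comp1m aE.
have [c [c1 c2]] := dist_map d d' E.
by exists c; apply: dist_five d d' aI (is_iso_id _) E c1 c2.
Qed.

Lemma tle_contrav_finite n : contrav_finite (tle T n).
Proof.
move=> X; have [L [V [[f [g [h d]]] aL bV]]] := truncation n X.
exists L, f; split=> // Z u aZ; apply: (dist_weak_kernel d).
exact: truncation_orth bV.
Qed.

Lemma bounded_tle X : bounded T -> exists n, tle T n X.
Proof. by move=> [b _]; have: setT X by []; rewrite -b => -[n _ Xn]; exists n. Qed.

Lemma bounded_tge X : bounded T -> exists n, tge T n X.
Proof. by move=> [_ b]; have: setT X by []; rewrite -b => -[n _ Xn]; exists n. Qed.

End Truncation.

(** * Kernels, cokernels and short exact sequences in the heart *)

Section Heart.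
Variables (D : triCat) (T : tStructure D).
Implicit Types (X Y Z W A B I K Q : D) (m n k : int).

Lemma heart_iso : iso_closed (heart_set T).
Proof. by move=> X Y XY [aX bX]; split; [apply: tle_iso aX|apply: tge_iso bX]. Qed.

Lemma heart_zero X : is_zero X -> heart_set T X.
Proof. by move=> X0; split; [apply: tle_zero|apply: tge_zero]. Qed.

Lemma heart_ext X Y Z : tri X Y Z -> heart_set T X -> heart_set T Z -> heart_set T Y.
Proof.
by move=> d [aX bX] [aZ bZ]; split; [apply: tle_ext d aX aZ|apply: tge_ext d bX bZ].
Qed.

(* K and Q are, up to shift, the two truncations of the cone of f, and I is the
   cocone of B -> Q. *)
Lemma heart_factor A B (f : hom A B) : heart_set T A -> heart_set T B ->
  exists K I Q (k : hom K A) (p : hom A I) r (j : hom I B) (c : hom B Q) s,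
  [/\ dist k p r, dist j c s, f = j \oc p
    & [/\ heart_set T K, heart_set T I & heart_set T Q]].
Proof.
move=> [aA bA] [aB bB]; have [Z [g [h fgh]]] := dist_ex f.
have ABZ : tri B Z (susp A) by apply: (proj1 (tri_rot A B Z)); exists f, g, h.
have aZ : tle T 0 Z.
  by apply: tle_ext ABZ aB _; apply/tle_susp; apply: tle_le aA.
have bZ : tge T (-1) Z.
  by apply: tge_ext ABZ _ _; [apply: tge_le bB|apply/tge_susp].
have [L [Q [[l [pi [t d]]] aL bQ]]] := truncation T (-1) Z.
have LZQ : tri L Z Q by exists l, pi, t.
have aQ : tle T 0 Q by apply: tle_tri3 LZQ _ aZ; apply: tle_le aL.
have bL : tge T (-1) L by apply: (@tge_tri1 _ _ (-2)) LZQ bZ _; apply: tge_le bQ.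
have [I [j [s djcs]]] := dist_cocone (pi \oc g).
have IBQ : tri I B Q by exists j, (pi \oc g), s.
have bI : tge T 0 I.
  by apply: (@tge_tri1 _ _ (-1)) IBQ bB _; apply: tge_le bQ.
have [|p fE] := dist_weak_kernel (u := f) djcs.
  by rewrite -compmA (dist_comp0 fgh) compm0.
have [M [r [r' dp]]] := dist_ex p.
rewrite fE in fgh.
have [u [v [duv _ _ vg _]]] := dist_oct dp djcs fgh.
(* The octahedron yields a morphism [v] that agrees with [pi] after [g]; the difference factors
   through [susp A], which is orthogonal to [Q]. *)
have vpi : v = pi.
  apply/eqP; rewrite -subr_eq0; apply/eqP.
  have [|w ->] := dist_weak_cokernel (u := v - pi) (proj1 (dist_rot _ _ _) fgh).
    by rewrite compmBl vg subrr.
  have aSA : tle T (-1) (susp A) by apply: (proj2 (tle_susp T (-1) A)).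
  by rewrite (truncation_orth w aSA bQ) comp0m.
(* Both [M] and [L] are cocones of [pi], so the cone [M] of [p] is the suspension of [desusp L], the
   future kernel. *)
have [x [y [yx xy]]] : isomorphic M (susp (desusp L)).
  apply: isomorphic_trans (isomorphic_sym (desuspK L)); apply/isomorphic_susp.
  have d3 := proj1 (dist_rot _ _ _) d; have duv3 := proj1 (dist_rot _ _ _) duv.
  have E : idm Q \oc v = pi \oc idm Z by rewrite comp1m compm1 vpi.
  have [x [x1 x2]] := dist_map duv3 d3 E.
  by exists x; apply: dist_five duv3 d3 (is_iso_id _) (is_iso_id _) E x1 x2.
have [k _ dk] : exists2 k : hom (desusp L) A,
    r' \oc y = - suspm k & dist k p (x \oc r).
  apply: dist_unrot.
  have xI : is_iso x by exists y.
  apply: dist_iso (is_iso_id _) (is_iso_id _) xI _ _ _ dp.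
  - by rewrite comp1m compm1.
  - by rewrite compm1.
  - by rewrite suspm1 comp1m -compmA yx compm1.
have aK : tle T 0 (desusp L) by apply: (proj2 (tle_shift T 0 (-1) L)).
have bK : tge T 0 (desusp L) by apply: (proj2 (tge_shift T 0 (-1) L)).
have aI : tle T 0 I.
  have AIK : tri A I (susp (desusp L)).
    by apply: (proj1 (tri_rot _ _ _)); exists k, p, (x \oc r).
  apply: tle_ext AIK aA _; apply: (proj2 (tle_susp _ _ _)); exact: tle_le aK.
by exists (desusp L), I, Q, k, p, (x \oc r), j, (pi \oc g), s.
Qed.

Lemma tle0_susp A W (u : hom (susp A) W) : tle T 0 A -> tge T 0 W -> u = 0.
Proof.
move=> aA; apply: (@truncation_orth _ _ (-1)).
by apply: (proj2 (tle_susp T (-1) A)).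
Qed.

(** The suspension of [u - v] factors through [Z], and [susp W] has no nonzero morphism to [Z]. *)
Lemma dist_mono X Y Z (f : hom X Y) (g : hom Y Z) h W (u v : hom W X) :
  dist f g h -> tge T 0 Z -> tle T 0 W -> f \oc u = f \oc v -> u = v.
Proof.
move=> d bZ aW fuv; apply: suspm_inj; apply/eqP; rewrite -subr_eq0; apply/eqP.
have [|w ->] := dist_weak_kernel (u := suspm u - suspm v)
    (proj1 (dist_rot _ _ _) (proj1 (dist_rot _ _ _) d)).
  by rewrite compmBr !compmNl -!suspmM fuv subrr.
by rewrite (tle0_susp w aW bZ) compm0.
Qed.

Lemma dist_epi X Y Z (f : hom X Y) (g : hom Y Z) h W (u v : hom Z W) :
  dist f g h -> tle T 0 X -> tge T 0 W -> u \oc g = v \oc g -> u = v.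
Proof.
move=> d aX bW ugv; apply/eqP; rewrite -subr_eq0; apply/eqP.
have [|w ->] := dist_weak_cokernel (u := u - v) (proj1 (dist_rot _ _ _) d).
  by rewrite compmBl ugv subrr.
by rewrite (tle0_susp w aX bW) comp0m.
Qed.

Lemma dist_short_exact (X Y Z : heart T) (f : hom X Y) (g : hom Y Z) h :
  @dist D (sval X) (sval Y) (sval Z) f g h -> short_exact f g.
Proof.
case: X Y Z f g h => [X hX] [Y hY] [Z hZ] /= f g h d.
split; split; try exact: (dist_comp0 d).
  case=> W [aW bW] u /(dist_weak_kernel d) [v vE]; exists v; split=> // v' v'E.
  by apply: (dist_mono d hZ.2 aW); rewrite -vE -v'E.
case=> W [aW bW] u /(dist_weak_cokernel d) [v vE]; exists v; split=> // v' v'E.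
by apply: (dist_epi d hX.1 bW); rewrite -vE -v'E.
Qed.

Definition hobj X (hX : heart_set T X) : heart T := exist _ X hX.

Lemma heart_factor_kernel (A B K I Q : heart T) (k : hom K A) (p : hom A I) r
    (j : hom I B) (c : hom B Q) s :
  @dist D (sval K) (sval A) (sval I) k p r ->
  @dist D (sval I) (sval B) (sval Q) j c s ->
  is_kernel (j \oc p) k.
Proof.
move=> dk dj; have [[pk uk] _] := dist_short_exact dk.
have jm := kernel_mono (dist_short_exact dj).1.
split; first by rewrite -compmA pk compm0.
move=> W u; rewrite -compmA => ju; apply: uk; apply: jm.
by rewrite ju compm0.
Qed.

Lemma heart_factor_cokernel (A B K I Q : heart T) (k : hom K A) (p : hom A I) r
    (j : hom I B) (c : hom B Q) s :
  @dist D (sval K) (sval A) (sval I) k p r ->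
  @dist D (sval I) (sval B) (sval Q) j c s ->
  is_cokernel (j \oc p) c.
Proof.
move=> dk dj; have [_ [cj uj]] := dist_short_exact dj.
have pe := cokernel_epi (dist_short_exact dk).2.
split; first by rewrite compmA cj comp0m.
move=> W u; rewrite compmA => ju; apply: uj; apply: pe.
by rewrite ju comp0m.
Qed.

Lemma heart_factorP (A B : heart T) (f : hom A B) :
  exists (K I Q : heart T) (k : hom K A) (p : hom A I) r (j : hom I B)
    (c : hom B Q) s,
  [/\ @dist D (sval K) (sval A) (sval I) k p r,
      @dist D (sval I) (sval B) (sval Q) j c s & f = j \oc p].
Proof.
have [K [I [Q [k [p [r [j [c [s [dk dj fE [hK hI hQ]]]]]]]]]]] :=
  @heart_factor (sval A) (sval B) f (svalP A) (svalP B).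
by exists (hobj hK), (hobj hI), (hobj hQ), k, p, r, j, c, s.
Qed.

(** Factor [f] as in [heart_factorP]: since [f] is a monomorphism, [K] vanishes and [p] is
    invertible, while [Q] and [Z] are both cokernels of [f]. *)
Lemma short_exact_dist (X Y Z : heart T) (f : hom X Y) (g : hom Y Z) :
  short_exact f g -> exists h, @dist D (sval X) (sval Y) (sval Z) f g h.
Proof.
move=> [kg cf]; have [K [I [Q [k [p [r [j [c [s [dk dj fE]]]]]]]]]] := heart_factorP f.
have k0 : k = 0.
  apply: (kernel_mono kg); rewrite fE -compmA.
  by rewrite (dist_comp0 dk : p \oc k = 0) compm0 compm0.
have K0 : is_zero K.
  apply: (kernel_mono (dist_short_exact dk).1).
  by rewrite k0 !comp0m.
have pI : is_iso (p : @hom D (sval X) (sval I)).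
  have d := proj1 (dist_rot _ _ _) dk.
  apply: (dist_zero_iso d).
  by apply: (proj2 (is_zero_susp _)).
have [b bI bE] : exists2 b : hom Q Z, is_iso b & b \oc c = g.
  have := cokernel_iso (heart_factor_cokernel dk dj); rewrite -fE; exact.
(* The connecting morphism [s], transported along the inverses of [p] and [b]. *)
exists (suspm (sval (cid pI)) \oc s \oc sval (cid bI)).
case: (cid pI) => p' /= [p1 p2]; case: (cid bI) => b' /= [b1 b2].
apply: (@dist_iso D _ _ _ j c s _ _ _ f g _ p' (idm (sval Y)) b) dj.
- by exists p.
- exact: is_iso_id.
- exact: bI.
- rewrite comp1m fE; rewrite -[LHS](compm1 (j : @hom D (sval I) (sval Y))) -p2.
  exact: compmA.
- by rewrite compm1; exact: bE.
- rewrite -compmA -[LHS](compm1 (suspm p' \oc s)); congr (_ \oc _).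
  exact: (esym b1).
Qed.

End Heart.

(** * Cohomology objects and their computation from truncations *)

Section Cohomology.
Variables (D : triCat) (T : tStructure D).
Implicit Types (X Y Z W A L V M : D) (m n k : int).

(* A is the cohomology object H^0 X, computed by any choice of truncation
   triangles. *)
Definition is_H0 X A := exists L V M,
  [/\ tri L X V, tle T 0 L /\ tge T 1 V, tri M L A & tle T (-1) M /\ heart_set T A].

Lemma H0P X : is_H0 X (sval (H0 T X)).
Proof.
have [f [g [h [aL bV d]]]] := tauP T X.
have [f' [g' [h' [aM bW d']]]] := tauP T (shift (tau_le0 T X) (-1)).
exists (tau_le0 T X), (tau_ge1 T X), (susp (tau_le0 T (shift (tau_le0 T X) (-1)))).
split; [by exists f, g, h|..|split; last exact: svalP].
- by split; [apply/tleE|apply/tgeE].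
- have : tri (tau_le0 T (shift (tau_le0 T X) (-1))) (shift (tau_le0 T X) (-1))
    (tau_ge1 T (shift (tau_le0 T X) (-1))) by exists f', g', h'.
  move/tri_susp; apply: tri_iso; try exact: isomorphic_refl.
  exact: desuspK.
- apply: (proj2 (tle_susp T (-1) _)).
  exact: (proj2 (tleE T 0 _) aM).
Qed.

Lemma is_H0_unique X Y A B :
  isomorphic X Y -> is_H0 X A -> is_H0 Y B -> isomorphic A B.
Proof.
move=> XY [L [V [M [d [aL bV] e [aM hA]]]]] [L' [V' [M' [d' [aL' bV'] e' [aM' hB]]]]].
have [LL' _] := truncation_unique (n := 0) d d' XY aL aL' bV bV'.
by have [_ AB] := truncation_unique (n := -1) e e' LL' aM aM' hA.2 hB.2.
Qed.

Definition HkD k X : D := sval (Hk T k X).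

Lemma HkP k X : is_H0 (shift X k) (HkD k X).
Proof. exact: H0P. Qed.

Lemma Hk_heart k X : heart_set T (HkD k X).
Proof. exact: svalP. Qed.

Lemma Hk_eq k X Y A : isomorphic (shift X k) Y -> is_H0 Y A -> isomorphic (HkD k X) A.
Proof. by move=> XY; apply: is_H0_unique XY (HkP k X). Qed.

Lemma Hk_iso k X Y : isomorphic X Y -> isomorphic (HkD k X) (HkD k Y).
Proof. by move=> XY; apply: Hk_eq (isomorphic_shift k XY) (HkP k Y). Qed.

Lemma Hk_shift k m X : isomorphic (HkD k (shift X m)) (HkD (m + k) X).
Proof. exact: Hk_eq (shiftD X m k) (HkP _ X). Qed.

Lemma Hk_susp k X : isomorphic (HkD k (susp X)) (HkD (k + 1) X).
Proof. by rewrite addrC; apply: (Hk_shift k 1). Qed.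

Lemma is_H0_zero_tle X O : is_zero O -> tle T (-1) X -> is_H0 X O.
Proof.
move=> O0 aX; exists X, O, X; split; try exact: tri_id.
  by split; [apply: tle_le aX|apply: tge_zero].
by split=> //; apply: heart_zero.
Qed.

Lemma is_H0_zero_tge X O : is_zero O -> tge T 1 X -> is_H0 X O.
Proof.
move=> O0 bX; exists O, X, O; split; first exact: tri_id0.
- by split; [apply: tle_zero|].
- exact: tri_id.
- by split; [apply: tle_zero|apply: heart_zero].
Qed.

Lemma is_H0_heart X : heart_set T X -> is_H0 X X.
Proof.
move=> hX; have [O O0] := zero_ex D; exists X, O, O; split; first exact: tri_id.
- by split; [case: hX|apply: tge_zero].
- exact: tri_id0.
- by split; [apply: tle_zero|].
Qed.

Lemma is_H0_top M X A : tri M X A -> tle T (-1) M -> heart_set T A -> is_H0 X A.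
Proof.
move=> d aM hA; have [O O0] := zero_ex D; exists X, O, M.
split=> //; first exact: tri_id.
split; last exact: tge_zero.
by apply: tle_ext d _ hA.1; apply: tle_le aM.
Qed.

(** By the octahedron [L] and [X] share the truncation [L']; the new coaisle part [Q] is an
    extension of [V] by [V']. *)
Lemma is_H0_truncation L X V A n : (0 <= n)%R -> tri L X V -> tge T (n + 1) V ->
  is_H0 L A -> is_H0 X A.
Proof.
move=> n0 d bV [L' [V' [M [d' [aL' bV'] e h]]]].
have [Q [d2 d3]] := tri_assocr d' d.
exists L', Q, M; split=> //; split=> //; apply: tge_ext d3 bV' _.
by apply: tge_le bV; lia.
Qed.

Lemma Hk_zero_tle k n X : (n < k)%R -> tle T n X -> is_zero (HkD k X).
Proof.
move=> nk aX; have [O O0] := zero_ex D; apply: (is_zero_iso _ O0).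
apply: isomorphic_sym.
apply: Hk_eq (isomorphic_refl _) _; apply: is_H0_zero_tle => //.
by apply/tle_shift; apply: tle_le aX; lia.
Qed.

Lemma Hk_zero_tge k n X : (k < n)%R -> tge T n X -> is_zero (HkD k X).
Proof.
move=> nk aX; have [O O0] := zero_ex D; apply: (is_zero_iso _ O0).
apply: isomorphic_sym.
apply: Hk_eq (isomorphic_refl _) _; apply: is_H0_zero_tge => //.
by apply/tge_shift; apply: tge_le aX; lia.
Qed.

Lemma heart_shift_tle n A : heart_set T A -> tle T n (shift A (- n)).
Proof. by move=> [aA _]; apply/tle_shift; rewrite addNr. Qed.

Lemma heart_shift_tge n A : heart_set T A -> tge T n (shift A (- n)).
Proof. by move=> [_ bA]; apply/tge_shift; rewrite addNr. Qed.

Lemma Hk_heart_shift k A : heart_set T A -> isomorphic (HkD k (shift A (- k))) A.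
Proof.
by move=> hA; apply: Hk_eq (shiftNK _ _) _; apply: is_H0_heart.
Qed.

Lemma Hk_heart_zero j k A : heart_set T A -> j <> k ->
  is_zero (HkD j (shift A (- k))).
Proof.
move=> hA jNk; have [jk|kj] : (j < k)%R \/ (k < j)%R by lia.
  exact: Hk_zero_tge jk (heart_shift_tge k hA).
exact: Hk_zero_tle kj (heart_shift_tle k hA).
Qed.

Lemma Hk_truncation k n L X V : (k <= n)%R -> tri L X V -> tge T (n + 1) V ->
  isomorphic (HkD k X) (HkD k L).
Proof.
move=> kn d bV; apply: Hk_eq (isomorphic_refl _) _.
apply: (@is_H0_truncation (shift L k) _ (shift V k) _ (n - k)) (HkP k L).
- lia.
- exact: (proj1 (tri_shift _ _ _ _)).
- by apply/tge_shift; apply: tge_le bV; lia.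
Qed.

Lemma Hk_top n X' X A : tri X' X (shift A (- n)) -> tle T (n - 1) X' ->
  heart_set T A -> isomorphic (HkD n X) A.
Proof.
move=> d aX hA; apply: Hk_eq (isomorphic_refl _) _.
apply: (@is_H0_top (shift X' n)) hA.
  move: d; rewrite (tri_shift _ _ _ n); apply: tri_iso; try exact: isomorphic_refl.
  exact: shiftNK.
by apply/tle_shift.
Qed.

Lemma top_cohomology n X : tle T n X -> exists X' A,
  [/\ tri X' X (shift A (- n)), tle T (n - 1) X' & heart_set T A].
Proof.
move=> aX; have [L [V [d aL bV]]] := truncation T (n - 1) X.
rewrite subrK in bV.
have aV : tle T n V by apply: tle_tri3 d _ aX; apply: tle_le aL; lia.
exists L, (shift V n); split=> //.
  apply: tri_iso d; try exact: isomorphic_refl.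
  exact/isomorphic_sym/shiftKN.
by split; [apply/tle_shift|apply/tge_shift]; rewrite addr0.
Qed.

Lemma tle_Hk_zero n X : tle T n X -> is_zero (HkD n X) -> tle T (n - 1) X.
Proof.
move=> /top_cohomology[X' [A [d aX' hA]]] H0.
apply: tle_iso (aX'); apply: tri_zero3 (d) _; apply/is_zero_shift.
exact: is_zero_iso (Hk_top d aX' hA) H0.
Qed.

(** Boundedness gives some upper bound [N], and each vanishing top cohomology lowers it by one until
    [n] is reached. *)
Lemma tle_Hk n X : bounded T -> (forall k, (n < k)%R -> is_zero (HkD k X)) -> tle T n X.
Proof.
move=> bT H0; have [N aX] := bounded_tle X bT.
have [Nn|nN] := Order.TotalTheory.leP N n; first exact: tle_le aX.
have := aX; have -> : N = n + `|N - n|%N%:Z by lia.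
elim: `|N - n|%N => [|m IH]; first by rewrite addr0.
move=> /tle_Hk_zero aX'; apply: IH.
have -> : n + m%:Z = n + m.+1%:Z - 1 by lia.
by apply: aX'; apply: H0; lia.
Qed.

(** * Splitting of idempotents *)

Lemma splits_susp X : splits (susp X) <-> splits X.
Proof.
split=> sX e ee.
  have [|Y [i [q [qi iq]]]] := sX (suspm e); first by rewrite -suspmM ee.
  have [a [b [ba ab]]] := desuspK Y.
  have [i' i'E] := suspm_surj (i \oc a); have [q' q'E] := suspm_surj (b \oc q).
  exists (desusp Y), i', q'; split; apply: suspm_inj; rewrite suspmM i'E q'E.
    by rewrite compmA -(compmA b) qi compm1 ba suspm1.
  by rewrite compmA -(compmA i) ab compm1.
have [e' e'E] := suspm_surj e.
have [|Y [i [q [qi iq]]]] := sX e'; first by apply: suspm_inj; rewrite suspmM e'E.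
by exists (susp Y), (suspm i), (suspm q); rewrite -!suspmM qi iq suspm1.
Qed.

Lemma splits_shift X n : splits (shift X n) <-> splits X.
Proof.
elim/int_ind1: n => // n.
suff -> : splits (shift X n) <-> splits (shift X (n + 1)) by [].
rewrite -splits_susp; split; apply: splits_iso; first exact: susp_shift.
exact/isomorphic_sym/susp_shift.
Qed.

Lemma splits_heart A : heart_set T A -> splits A.
Proof.
move=> hA e ee.
have [K [I [Q [k [p [r [j [c [s [dk dj eE [hK hI hQ]]]]]]]]]]] := heart_factor e hA hA.
exists I, j, p; split=> //.
apply: (dist_mono dj hQ.2 hI.1); rewrite compm1.
apply: (dist_epi dk hK.1 hA.2).
by rewrite -eE compmA -eE -compmA -eE.
Qed.

(* The truncation triangle is functorial, so an idempotent of X induces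
   idempotents of L and V; the direct sum of their images, glued along the
   connecting morphism, carries an idempotent of X that differs from the given
   one by a morphism of square zero. *)
Lemma splits_truncation n L X V : tri L X V -> tle T n L -> tge T (n + 1) V ->
  splits L -> splits V -> splits X.
Proof.
move=> [f [g [h d]]] aL bV sL sV e ee.
have d2 := proj1 (dist_rot _ _ _) d.
have gef0 : g \oc (e \oc f) = 0 by apply: truncation_orth aL bV.
have [eL eLE] := dist_weak_kernel d gef0.
have eLL : eL \oc eL = eL.
  apply: suspm_inj; apply/eqP; rewrite -subr_eq0; apply/eqP.
  have [|w ->] := dist_weak_kernel (u := suspm (eL \oc eL) - suspm eL)
      (proj1 (dist_rot _ _ _) d2).
    by rewrite compmBr !compmNl -!suspmM compmA -eLE -compmA -eLE compmA ee subrr.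
  by rewrite (truncation_susp_orth w aL bV) compm0.
have [eV [eVE1 eVE2]] := dist_map d d eLE.
have eVV : eV \oc eV = eV.
  apply/eqP; rewrite -subr_eq0; apply/eqP.
  have [|w ->] := dist_weak_cokernel (u := eV \oc eV - eV) d2.
    by rewrite compmBl -compmA eVE1 compmA eVE1 -compmA ee subrr.
  by rewrite (truncation_susp_orth w aL bV) comp0m.
have [EL [iL [qL [qiL iqL]]]] := sL _ eLL.
have [EV [iV [qV [qiV iqV]]]] := sV _ eVV.
have [EX [fE [gE dE]]] := dist_ex3 (suspm qL \oc h \oc iV).
have [|iX [iX1 iX2]] := dist_map_mid (a := iL) (c := iV) dE d.
  by rewrite !compmA -suspmM iqL eVE2 -compmA -iqV -compmA qiV compm1.
have [|qX [qX1 qX2]] := dist_map_mid (a := qL) (c := qV) d dE.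
  by rewrite -[RHS]compmA iqV -compmA -eVE2 compmA -suspmM -iqL compmA qiL comp1m.
have nil (u : hom EX EX) : u \oc fE = 0 -> gE \oc u = 0 -> u \oc u = 0.
  move=> uf gu; have [w wE] := dist_weak_cokernel dE uf.
  by rewrite {1}wE -compmA gu compm0.
(* The composite [qX \oc iX] is the identity up to a morphism of square zero; its inverse [w]
   corrects [qX] and is compatible with [fE] and [gE]. *)
have [w [w1 w2]] : exists w : hom EX EX, w \oc (qX \oc iX) = idm EX /\
    (w \oc fE = fE /\ gE \oc w = gE).
  have uf : (qX \oc iX - idm EX) \oc fE = 0.
    by rewrite compmBl comp1m -compmA iX1 compmA qX1 -compmA qiL compm1 subrr.
  have gu : gE \oc (qX \oc iX - idm EX) = 0.
    by rewrite compmBr compm1 compmA qX2 -compmA iX2 compmA qiV comp1m subrr.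
  have [w [w1 w2]] := unipotent_iso (nil _ uf gu); exists w; split=> //; split.
    transitivity (w \oc (qX \oc iX \oc fE)); last by rewrite compmA w1 comp1m.
    by congr (_ \oc _); move/eqP: uf; rewrite compmBl comp1m subr_eq0 => /eqP.
  transitivity (gE \oc (qX \oc iX) \oc w); last by rewrite -compmA w2 compm1.
  by congr (_ \oc _); move/eqP: gu; rewrite compmBr compm1 subr_eq0 => /eqP.
exists EX; apply: (split_idem_perturb (i := iX) (q := w \oc qX)) => //.
  by rewrite -compmA.
have df : (e - iX \oc (w \oc qX)) \oc f = 0.
  rewrite compmBl -!compmA qX1 (compmA w) w2.1 compmA iX1 -compmA iqL.
  by rewrite eLE subrr.
have gd : g \oc (e - iX \oc (w \oc qX)) = 0.
  rewrite compmBr !compmA iX2 -(compmA _ gE) w2.2 -compmA qX2 compmA iqV.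
  by rewrite eVE1 subrr.
have [u uE] := dist_weak_cokernel d df.
by rewrite {1}uE -compmA gd compm0.
Qed.

Lemma bounded_splits X : bounded T -> splits X.
Proof.
move=> bT; have [n aX] := bounded_tle X bT; have [m bX] := bounded_tge X bT.
(* The induction runs on the number [N] of degrees, from [n + 1 - N] to [n], that [X] may occupy. *)
have : tge T (n + 1 - (absz (n + 1 - m)%R)%:Z) X by apply: tge_le bX; lia.
move: (absz _) => N {bX}; elim: N n X aX => [|N IH] n X aX bX.
  move=> e _; have X0 : is_zero X by apply: tle_tge_zero aX bX; lia.
  exists X, (idm X), e.
  by split; apply: etrans (is_zero_hom0l X0 _) (esym (is_zero_hom0l X0 _)).
have [X' [A [d aX' hA]]] := top_cohomology aX.
apply: (splits_truncation d aX').
- by rewrite subrK; apply: heart_shift_tge.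
- apply: (IH (n - 1)) => //.
  have -> : n - 1 + 1 - N%:Z = n - N%:Z - 1 + 1 by lia.
  apply: tge_tri1 d _ _; first by apply: tge_le bX; lia.
  by apply: tge_le (heart_shift_tge n hA); lia.
- by apply/splits_shift; apply: splits_heart.
Qed.

End Cohomology.

(** * From contravariantly finite preaisles to aisles *)

Section Aisles.
Variables (D : triCat) (T : tStructure D).
Implicit Types (X Y Z W A L V M E : D) (m n k : int) (U : set D).

Definition tri_closed U := forall X Y Z, tri X Y Z -> U X -> U Z -> U Y.
Definition susp_closed U := forall X, U X -> U (susp X).

Lemma tri_closed_subcat U : (forall X, is_zero X -> U X) -> tri_closed U ->
  iso_closed U -> subcat U.
Proof.
by move=> U0 Ue Ui; split=> // X Y S /biproduct_tri d; apply: Ue d.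
Qed.

(* An object X and its complement X' in an object of U are built out of
   that object and the suspensions of X' and X; iterating lands in a part of D
   where U is everything. *)
Lemma bounded_summand_closed U m : bounded T -> tle T m `<=` U ->
  tri_closed U -> susp_closed U -> forall X X' Y, is_biproduct X X' Y -> U Y -> U X.
Proof.
move=> bT mU Ue Us X X' Y XX'Y UY.
have d := biproduct_tri XX'Y; have d' := biproduct_tri (biproduct_sym XX'Y).
have [n aX] := bounded_tle X bT; have [n' aX'] := bounded_tle X' bT.
suff: U X /\ U X' by case.
suff H N : U (iter N susp X) /\ U (iter N susp X') -> U X /\ U X'.
  (* This many suspensions carry both [X] and [X'] into [tle T m]. *)
  apply: (H (absz (n - m)%R + absz (n' - m)%R)%N).
  by split; apply: mU; [apply: (proj2 (tle_shift T m (Posz _) X)) |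
     apply: (proj2 (tle_shift T m (Posz _) X'))]; [apply: tle_le aX|apply: tle_le aX'];
     rewrite PoszD; lia.
elim: N => // N IH [U1 U2]; apply: IH.
have UYN : U (iter N susp Y) by elim: N {U1 U2} => //= N; apply: Us.
have dN := proj1 (tri_shift _ _ _ N%:Z) d; have dN' := proj1 (tri_shift _ _ _ N%:Z) d'.
by split; [move/tri_rot: dN'|move/tri_rot: dN] => e; apply: Ue e UYN _.
Qed.

Definition perp U : set D := [set V | forall W, U W -> hom0 W V].

Lemma perp_subcat U : subcat (perp U).
Proof.
apply: tri_closed_subcat.
- by move=> X X0 W _; apply: is_zero_hom0r.
- by move=> X Y Z d pX pZ W UW; apply: tri_hom0r d (pX W UW) (pZ W UW).
- by move=> X Y XY pX W UW; apply: hom0_iso (isomorphic_refl _) XY (pX W UW).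
Qed.

Lemma perp_shift U : susp_closed U -> shift_set (perp U) (-1) `<=` perp U.
Proof.
move=> Us X [Y pY XY] W UW.
apply: (hom0_iso (isomorphic_refl _) (isomorphic_sym XY)).
apply/hom0_susp; apply: hom0_iso (isomorphic_refl _) _ (pY _ (Us _ UW)).
exact/isomorphic_sym/desuspK.
Qed.

(* If U1 -> U0 covers the cocone of a U-cover f of X and u : U0 -> C is the
   cone of U1 -> U0, then f factors through u, which yields an idempotent of
   U0 whose image is the coreflection of X. *)
Lemma precover_coreflection U : (forall X, splits X) -> tri_closed U ->
  susp_closed U -> (forall X X' Y, is_biproduct X X' Y -> U Y -> U X) ->
  contrav_finite U -> forall X, exists E (f : hom E X), U E /\
    forall W (g : hom W X), U W -> exists! h : hom W E, g = f \oc h.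
Proof.
move=> spl Ue Us Usum cU X.
have [U0 [f [UU0 fP]]] := cU X.
have [K [k [r dk]]] := dist_cocone f.
have [U1 [g [UU1 gP]]] := cU K.
have [C [u [s du]]] := dist_ex (k \oc g).
have UC : U C.
  apply: (Ue U0 C (susp U1)) => //; last exact: Us.
  by apply: (proj1 (tri_rot _ _ _)); exists (k \oc g), u, s.
have [|f' fE] := dist_weak_cokernel (u := f) du.
  by rewrite compmA (dist_comp0 dk) comp0m.
have [v vE] := fP _ f' UC.
(* A morphism from [U] killed by [f] factors through [K], then through [U1], and so dies in the cone
   [C]. *)
have kill W (a : hom W U0) : U W -> f \oc a = 0 -> u \oc a = 0.
  move=> UW /(dist_weak_kernel dk)[b ->]; have [c ->] := gP _ b UW.
  by rewrite (compmA k) compmA (dist_comp0 du) comp0m.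
have ue : u \oc (v \oc u) = u.
  apply/eqP; rewrite eq_sym -subr_eq0 -{1}[u]compm1 -compmBr; apply/eqP/kill => //.
  by rewrite compmBr compm1 compmA -vE -fE subrr.
have [|E [i [q [qi iq]]]] := spl U0 (v \oc u).
  by rewrite -compmA ue.
have [|E' [i' [q' [qi' iq']]]] := spl U0 (idm U0 - v \oc u).
  by rewrite compmBl comp1m compmBr compm1 -compmA ue subrr subr0.
have UE : U E.
  by apply: (Usum E E' U0) UU0; apply: split_biproduct qi qi' _; rewrite iq' iq.
exists E, (f \oc i); split=> // W h UW.
have [a aE] := fP _ h UW; exists (q \oc a); split.
  by rewrite compmA -(compmA f) iq compmA -vE -fE.
have inj (b : hom W E) : f \oc i \oc b = 0 -> b = 0.
  move=> /eqP; rewrite -compmA => /eqP /(kill _ _ UW) uib.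
  have ib0 : i \oc b = 0.
    transitivity (v \oc (u \oc (i \oc b))); last by rewrite uib compm0.
    by rewrite compmA -iq -compmA (compmA q) qi comp1m.
  by rewrite -[b]comp1m -qi -compmA ib0 compm0.
move=> b bE; apply/eqP; rewrite -subr_eq0; apply/eqP; apply: inj.
rewrite compmBr -bE {1}aE; apply/eqP; rewrite subr_eq0; apply/eqP.
by rewrite compmA -(compmA f) iq compmA -vE -fE.
Qed.

(** The point is that the cone [V] of the coreflection is orthogonal to [U]. Pulling back along
    [a : W -> V] gives an extension [P] of [W] by [E] in [U]; its map to [X] factors through [f],
    which splits [i] and forces [h \oc a = 0]. So [a] lifts to [X], then to [E], and vanishes. *)
Lemma coreflection_tStructure U : subcat U -> tri_closed U -> susp_closed U ->
  (forall X, exists E (f : hom E X), U E /\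
    forall W (g : hom W X), U W -> exists! h : hom W E, g = f \oc h) ->
  exists T' : tStructure D, aisle T' = U.
Proof.
move=> Usub Ue Us cor.
have tr X : exists E V, exists (f : hom E X) (g : hom X V) h,
    [/\ U E, perp U V & dist f g h].
  have [E [f [UE fP]]] := cor X; have [V [g [h d]]] := dist_ex f.
  exists E, V, f, g, h; split=> // W UW a.
  have [P [i [p d']]] := dist_ex3 (h \oc a).
  have UP : U P by apply: Ue UE UW; exists i, p, (h \oc a).
  have [|c [ci _]] := dist_map_mid (a := idm E) (c := a) d' d.
    by rewrite suspm1 comp1m.
  rewrite compm1 in ci.
  have [b [bE _]] := fP _ c UP.
  have bi : b \oc i = idm E.
    have [x [_ xu]] := fP _ f UE.
    rewrite -(xu (b \oc i)) ?(xu (idm E)) ?compm1 //.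
    by rewrite compmA -bE ci.
  have ha : h \oc a = 0.
    have := dist_comp0 (proj1 (dist_rot _ _ _) (proj1 (dist_rot _ _ _) d')).
    rewrite compmNl => /eqP; rewrite oppr_eq0 => /eqP iha.
    by rewrite -[h \oc a]comp1m -suspm1 -bi suspmM -compmA iha compm0.
  have [y yE] := dist_weak_kernel (proj1 (dist_rot _ _ _) d) ha.
  have [z [zE _]] := fP _ y UW.
  by rewrite yE zE compmA (dist_comp0 d) comp0m.
have Ush : shift_set U 1 `<=` U.
  move=> X [Y UY XY]; have [_ _ Ui] := Usub.
  by apply: Ui (isomorphic_sym XY) _; apply: Us.
by exists (TStructure Usub (perp_subcat U) Ush (perp_shift Us)
  (fun X Y f UX pY => pY X UX f) tr).
Qed.

Lemma aisle_tri_closed : tri_closed (aisle T).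
Proof.
have E X : aisle T X <-> tle T 0 X by rewrite tleE.
by move=> X Y Z d; rewrite !E; apply: tle_ext.
Qed.

Lemma coaisle_perp X : (forall W, aisle T W -> hom0 W X) -> coaisle T X.
Proof.
move=> h; suff: tge T 1 X by rewrite tgeE.
by apply: (@tge_orth _ _ 0) => W /tleE; apply: h.
Qed.

End Aisles.

(** * Objects with prescribed cohomology form an aisle *)

Section Theta.
Variables (D : triCat) (T : tStructure D).
Implicit Types (X Y Z W A B E G K I Q : D) (m n k : int).

(** The form in which ICE sequences are used in [D], with triangles in place of short exact
    sequences. The field [ice_kercoker] combines the conditions on [alpha] and on torsion classes:
    for a morphism from degree [m] to degree [m + 1], the kernel belongs to degree [m] and the
    cokernel to degree [m + 1]. *)
Record ice_data (P : int -> set D) : Prop := IceData {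
  ice_heart : forall k X, P k X -> heart_set T X;
  ice_zero : forall k X, is_zero X -> P k X;
  ice_iso : forall k, iso_closed (P k);
  ice_ext : forall k, tri_closed (P k);
  ice_anti : forall k, P (k + 1) `<=` P k;
  ice_kercoker : forall m A B K I Q (k : hom K A) (p : hom A I) r
    (j : hom I B) (c : hom B Q) s, dist k p r -> dist j c s ->
    heart_set T K -> heart_set T I -> heart_set T Q ->
    P m A -> P (m + 1) B -> P m K /\ P (m + 1) Q }.

Variables (P : int -> set D).
Hypotheses (iP : ice_data P) (bT : bounded T).

Definition cohom_in : set D := [set X | forall k, P k (HkD T k X)].
Local Notation U := cohom_in.

Lemma cohom_in_iso : iso_closed U.
Proof. by move=> X Y XY UX k; apply: ice_iso iP _ _ _ (Hk_iso _ _ XY) (UX k). Qed.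

Lemma cohom_in_zero X : is_zero X -> U X.
Proof.
move=> X0 k; apply: ice_zero iP _ _ _.
by apply: (@Hk_zero_tle _ _ k (k - 1)); [lia|apply: tle_zero].
Qed.

Lemma ice_le m n : (m <= n)%R -> P n `<=` P m.
Proof.
move=> mn; have -> : n = m + (absz (n - m)%R)%:Z by lia.
move: (absz _) => N; elim: N => [|N IH] X; first by rewrite addr0.
have -> : m + N.+1%:Z = m + N%:Z + 1 by lia.
by move=> /(ice_anti iP)/IH.
Qed.

Lemma cohom_in_susp : susp_closed U.
Proof.
move=> X UX k; apply: (ice_iso iP (isomorphic_sym (Hk_susp T k X))).
by apply: (ice_anti iP); apply: UX.
Qed.

Lemma cohom_in_heart k A : heart_set T A -> U (shift A (- k)) <-> P k A.
Proof.
move=> hA; split=> [/(_ k)|PA j]; first exact: (ice_iso iP (Hk_heart_shift k hA)).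
have [->|jk] := eqVneq j k.
  exact: (ice_iso iP (isomorphic_sym (Hk_heart_shift k hA))).
by apply: (ice_zero iP); apply: Hk_heart_zero => //; apply/eqP.
Qed.

(** Passing to [X'] keeps the cohomology in degrees below [n], and [A] is the cohomology of [X] in
    degree [n]. *)
Lemma cohom_in_filtration n X' X A : tri X' X (shift A (- n)) ->
  tle T (n - 1) X' -> heart_set T A -> U X <-> U X' /\ P n A.
Proof.
move=> d aX' hA.
have bA : tge T (n - 1 + 1) (shift A (- n)) by rewrite subrK; apply: heart_shift_tge.
have aX : tle T n X.
  by apply: tle_ext d _ (heart_shift_tle n hA); apply: tle_le aX'; lia.
split=> [UX|[UX' PA] k].
  split; last exact: ice_iso iP _ _ _ (Hk_top d aX' hA) (UX n).
  move=> k; have [kn|nk] := Order.TotalTheory.leP k (n - 1).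
    exact: ice_iso iP _ _ _ (Hk_truncation kn d bA) (UX k).
  by apply: (ice_zero iP); apply: Hk_zero_tle nk aX'.
have [kn|nk] := Order.TotalTheory.leP k (n - 1).
  exact: ice_iso iP _ _ _ (isomorphic_sym (Hk_truncation kn d bA)) (UX' k).
have [->|kNn] := eqVneq k n.
  exact: ice_iso iP _ _ _ (isomorphic_sym (Hk_top d aX' hA)) PA.
by apply: (ice_zero iP); apply: Hk_zero_tle aX; lia.
Qed.

(** Split [Z] into its top cohomology [E], in degree [n - 1], and the rest [Z1]. The layer of [A]
    commutes with [Z1]; exchanging it with that of [E] replaces the pair by the kernel and the
    cokernel of a morphism [f : E -> A]. *)
Lemma cohom_in_swap n A Z W : tri (shift A (- n)) W Z -> P n A -> U Z ->
  tle T (n - 1) Z -> exists Z' A',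
  [/\ tri Z' W (shift A' (- n)), P n A', U Z' & tle T (n - 1) Z'].
Proof.
move=> d PA UZ aZ; have hA := ice_heart iP PA.
have [Z1 [E [d1 aZ1 hE]]] := top_cohomology aZ.
have [UZ1 PE] := proj1 (cohom_in_filtration d1 aZ1 hE) UZ.
have [Y [dY dW]] := tri_assocl d d1.
(* [Z1] lies in degrees at most [n - 2] and the suspension of [A[-n]] in degree [n - 1], so this
   extension splits. *)
have dY' : tri Z1 Y (shift A (- n)).
  apply: tri_split dY _; apply: (@tle_tge_hom0 _ T (n - 1 - 1) (n - 1)) => //.
    lia.
  by apply: (proj2 (tge_susp _ _ _)); rewrite subrK; apply: heart_shift_tge.
have [G [dG1 dG2]] := tri_assocr dY' dW.
(* Up to shift, G is the cocone of a morphism E -> A in the heart. *)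
have [f [g [h dG]]] : tri E A (shift (susp G) (n - 1)).
  have := proj1 (tri_rot _ _ _) (proj1 (tri_rot _ _ _) dG2).
  move/(tri_shift _ _ _ (n - 1)); apply: tri_iso; try exact: isomorphic_refl.
    exact: shiftNK.
  apply: isomorphic_trans (shift_susp _ _) _; rewrite subrK; exact: shiftNK.
have [K [I [Q [k [p [r [j [c [s [dk dj fE [hK hI hQ]]]]]]]]]]] := heart_factor f hE hA.
rewrite fE in dG.
have PA' : P (n - 1 + 1) A by rewrite subrK.
have [PK PQ] := ice_kercoker iP dk dj hK hI hQ PE PA'; rewrite subrK in PQ.
have dG3 : tri (shift K (- (n - 1))) G (shift Q (- n)).
  have := cone_filtration dk dj dG.
  move/(tri_shift _ _ _ (- n)); apply: tri_iso; try exact: isomorphic_refl.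
    have -> : - (n - 1) = - n + 1 by lia.
    exact: shift_susp.
  apply: isomorphic_trans (shiftD _ _ _) _.
  have -> : n - 1 - n = -1 by lia.
  exact: desusp_susp.
have [Z' [dZ1 dZ2]] := tri_assocl dG1 dG3.
have aZ' : tle T (n - 1) Z'.
  apply: tle_ext dZ1 _ (heart_shift_tle _ hK).
  by apply: tle_le aZ1; lia.
by exists Z', Q; split=> //; apply/(cohom_in_filtration dZ1 aZ1 hK).
Qed.

(** Induction on the number [N] of degrees that [X] may occupy. After the exchange, the top layer
    [C] extends [B[-n]] by [A2[-n]], and the rest [X2] extends [Z2] by [X'], which needs one degree
    fewer. *)
Lemma cohom_in_ext_tle N n X Y Z : tle T n X -> tge T (n + 1 - N%:Z) X -> tle T n Z ->
  U X -> U Z -> tri X Y Z -> U Y.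
Proof.
elim: N n X Y Z => [|N IH] n X Y Z aX bX aZ UX UZ d.
  apply: cohom_in_iso UZ; apply: isomorphic_sym; apply: tri_zero1 d _.
  by apply: tle_tge_zero aX bX; lia.
have [X' [A [dX aX' hA]]] := top_cohomology aX.
have [Z' [B [dZ aZ' hB]]] := top_cohomology aZ.
have [UX' PA] := proj1 (cohom_in_filtration dX aX' hA) UX.
have [UZ' PB] := proj1 (cohom_in_filtration dZ aZ' hB) UZ.
(* Y is filtered by X', A[-n], Z', B[-n]; the middle two are exchanged. *)
have [R [dY1 dY2]] := tri_assocr dX d.
have [S [dR1 dR2]] := tri_assocl dY2 dZ.
have [Z2 [A2 [dS PA2 UZ2 aZ2]]] := cohom_in_swap dR1 PA UZ' aZ'.
have [C [dC1 dC2]] := tri_assocr dS dR2.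
have [X2 [dX1 dX2]] := tri_assocl dY1 dC1.
have aX2 : tle T (n - 1) X2 by apply: tle_ext dX1 _ _.
have UX2 : U X2.
  apply: (IH (n - 1) X' X2 Z2) => //.
  have -> : n - 1 + 1 - N%:Z = n - N%:Z - 1 + 1 by lia.
  apply: tge_tri1 dX _ _; first by apply: tge_le bX; lia.
  by apply: tge_le (heart_shift_tge n hA); lia.
have PC : P n (shift C n).
  apply: (ice_ext iP _ PA2 PB); move/(tri_shift _ _ _ n): dC2.
  by apply: tri_iso; try exact: isomorphic_refl; apply: shiftNK.
apply: (proj2 (cohom_in_filtration (n := n) (A := shift C n) _ aX2 _)).
- by apply: tri_iso dX2; try exact: isomorphic_refl; apply/isomorphic_sym/shiftKN.
- exact: (ice_heart iP PC).
- by split.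
Qed.

Lemma cohom_in_ext : tri_closed U.
Proof.
move=> X Y Z d UX UZ.
have [n aX] := bounded_tle X bT; have [n' aZ] := bounded_tle Z bT.
have [m bX] := bounded_tge X bT.
pose M := (absz n)%:Z + (absz n')%:Z.
apply: (@cohom_in_ext_tle (absz (M + 1 - m)%R) M X Y Z) => //.
- by apply: tle_le aX; rewrite /M; lia.
- by apply: tge_le bX; lia.
- by apply: tle_le aZ; rewrite /M; lia.
Qed.

Lemma cohom_in_subcat : subcat U.
Proof.
exact: tri_closed_subcat cohom_in_zero cohom_in_ext cohom_in_iso.
Qed.

(** Up to degree [m] the set is all of [tle T m], where truncation gives the approximations; each
    further degree [n] contributes a factor [P n], shifted, to a [star] product. *)
Lemma cohom_in_contrav_finite_tle m N : (forall X, heart_set T X -> P m X) ->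
  (forall k, contrav_finite (P k)) -> contrav_finite (U `&` tle T (m + N%:Z)).
Proof.
move=> Pm cP; elim: N => [|N IH].
  suff -> : U `&` tle T (m + 0) = tle T m by apply: tle_contrav_finite.
  rewrite addr0; apply/seteqP; split=> [X []//|X aX]; split=> // k.
  have [km|mk] := Order.TotalTheory.leP k m.
    by apply: (ice_le km); apply: Pm; apply: Hk_heart.
  by apply: (ice_zero iP); apply: Hk_zero_tle mk aX.
set n := m + N.+1%:Z; have nE : n - 1 = m + N%:Z by rewrite /n; lia.
rewrite -nE in IH.
have cPn : contrav_finite [set X | P n (shift X n)].
  exact: contrav_finite_shift (@ice_iso _ iP n) (cP n).
have := contrav_finite_star IH cPn; congr contrav_finite.
apply/seteqP; split=> X.
  move=> [X' [V [[UX' aX'] PV d]]]; have hV := ice_heart iP PV.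
  have d' : tri X' X (shift (shift V n) (- n)).
    by apply: tri_iso d; try exact: isomorphic_refl; apply/isomorphic_sym/shiftKN.
  split; first exact/(cohom_in_filtration d' aX' hV).
  by apply: tle_ext d' _ (heart_shift_tle _ hV); apply: tle_le aX'; lia.
move=> [UX aX]; have [X' [A [d aX' hA]]] := top_cohomology aX.
have [UX' PA] := proj1 (cohom_in_filtration d aX' hA) UX.
exists X', (shift A (- n)); split=> //.
exact: (ice_iso iP (isomorphic_sym (shiftNK A n))).
Qed.

Lemma cohom_in_full m n : (forall X, heart_set T X -> P m X) -> P n `<=` @is_zero D ->
  tle T m `<=` U /\ U `<=` tle T (n - 1).
Proof.
move=> Pm Pn; split=> X.
  move=> aX k; have [km|mk] := Order.TotalTheory.leP k m.
    by apply: (ice_le km); apply: Pm; apply: Hk_heart.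
  by apply: (ice_zero iP); apply: Hk_zero_tle mk aX.
move=> UX; apply: tle_Hk => // k nk; apply: Pn; apply: (@ice_le n k); first lia.
exact: UX.
Qed.

Lemma cohom_in_aisle m n : (forall X, heart_set T X -> P m X) ->
  P n `<=` @is_zero D -> (forall k, contrav_finite (P k)) ->
  exists T' : tStructure D, aisle T' = U.
Proof.
move=> Pm Pn cP; have [mU Un] := cohom_in_full Pm Pn.
apply: coreflection_tStructure cohom_in_subcat cohom_in_ext cohom_in_susp _.
apply: precover_coreflection cohom_in_ext cohom_in_susp _ _.
- by move=> X; apply: bounded_splits bT.
- exact: bounded_summand_closed bT mU cohom_in_ext cohom_in_susp.
(* [U] lies in [tle T (n - 1)], so intersecting with a large enough [tle] changes nothing. *)
suff -> : U = U `&` tle T (m + (absz (n - 1 - m)%R)%:Z).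
  exact: cohom_in_contrav_finite_tle.
apply/esym/setIidl => X /Un; apply: tle_le; lia.
Qed.

End Theta.

(** * ICE sequences of the heart seen inside the triangulated category *)

Section ICEHeart.
Variables (D : triCat) (T : tStructure D).
Implicit Types (A B K I Q M N W : heart T) (C : set (heart T)).

(** Kernels tested on objects of the heart but stated in [D], so that they make sense for an object
    built by a triangle before it is known to lie in the heart. *)
Definition heart_kernel (X Y K : D) (f : hom X Y) (k : hom K X) :=
  f \oc k = 0 /\ forall W : D, heart_set T W -> forall u : hom W X, f \oc u = 0 ->
    exists! v : hom W K, k \oc v = u.

Lemma heart_kernelP (X Y K : heart T) (f : hom X Y) (k : hom K X) :
  @heart_kernel (sval X) (sval Y) (sval K) f k <-> is_kernel f k.
Proof.
split=> [[fk uk]|[fk uk]]; split=> //; first by move=> [W hW]; apply: uk.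
by move=> W hW; apply: (uk (hobj hW)).
Qed.

(* E is the pullback of h along the epimorphism c, so phi and h have the same
   kernel. *)
Lemma pullback_kernel (I N Q W K E : D) (j : hom I N) (c : hom N Q) s
    (h : hom W Q) (k : hom K W) (i : hom I E) (e : hom E W) :
  dist j c s -> dist i e (s \oc h) -> heart_set T I -> heart_set T Q ->
  heart_set T W -> heart_set T K ->
  heart_kernel h k -> exists (phi : hom E N) (k' : hom K E), heart_kernel phi k'.
Proof.
move=> dj di hI hQ hW hK [hk uk].
have [|phi [phii cphi]] := dist_map_mid (a := idm I) (c := h) di dj.
  by rewrite suspm1 comp1m.
rewrite compm1 in phii.
have di2 := proj1 (dist_rot _ _ _) di.
have [|k1 k1E] := dist_weak_kernel (u := k) di2.
  by rewrite -compmA hk compm0.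
have [|t tE] := dist_weak_kernel (u := phi \oc k1) dj.
  by rewrite compmA cphi -compmA -k1E hk.
have ei : e \oc i = 0 := dist_comp0 di.
(* The lift [k1] of [k] satisfies only [phi \oc k1 = j \oc t]; since [phi \oc i = j], this
   correction makes the composite zero. *)
pose k' := k1 - i \oc t.
have ek' : e \oc k' = k by rewrite compmBr compmA ei comp0m subr0.
have pk' : phi \oc k' = 0 by rewrite compmBr compmA phii tE subrr.
exists phi, k'; split=> // V hV u pu.
have [|v [vE vu]] := uk V hV (e \oc u).
  by rewrite compmA -cphi -compmA pu compm0.
exists v; split; last first.
  by move=> v' v'E; apply: vu; rewrite -ek' -compmA v'E.
apply/eqP; rewrite eq_sym -subr_eq0; apply/eqP.
have [|x xE] := dist_weak_kernel (u := u - k' \oc v) di.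
  by rewrite compmBr compmA ek' vE subrr.
rewrite xE.
have -> : x = 0; last by rewrite compm0.
apply: (dist_mono dj hQ.2 hV.1); rewrite compm0 -phii -compmA -xE.
by rewrite compmBr pu compmA pk' comp0m subr0.
Qed.

(** For [h : W -> Q], the pullback [E] along [c] extends [W] by the image [I], so it lies in [C].
    Its morphism to [N] has the same kernel as [h], and [N] is in [alpha C]. *)
Lemma alpha_cokernel C M N I Q K (k : hom K M) (p : hom M I) r (j : hom I N)
    (c : hom N Q) s :
  @dist D (sval K) (sval M) (sval I) k p r ->
  @dist D (sval I) (sval N) (sval Q) j c s ->
  ICE_closed C -> C M -> alpha C N -> alpha C Q.
Proof.
move=> dk dj [[_ _ Ci] Ce Cim Cco] CM [CN kN].
have cj := heart_factor_cokernel dk dj.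
have CI : C I.
  by apply: (Cim _ _ (j \oc p) CM CN I j); exists Q, c; split=> //;
    case: (dist_short_exact dj).
have CQ : C Q by apply: (Cco _ _ (j \oc p) CM CN Q c).
split=> // W h CW K' k' /heart_kernelP kk'.
have [E [i [e di]]] := dist_ex3 (s \oc h : @hom D (sval W) (susp (sval I))).
have hE : heart_set T E.
  apply: (heart_ext (X := sval I) (Z := sval W)); try exact: svalP.
  by exists i, e, (s \oc h).
have CE : C (hobj hE).
  apply: (Ce I (hobj hE) W i e) => //.
  by apply: (@dist_short_exact D T I (hobj hE) W i e (s \oc h)).
have [phi [k'' /(@heart_kernelP (hobj hE) N K') kk'']] :=
  pullback_kernel dj di (svalP I) (svalP Q) (svalP W) (svalP K') kk'.
exact: kN kk''.
Qed.

Definition heart_lift C : set D := [set X | exists hX : heart_set T X, C (hobj hX)].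

Lemma heart_liftE C (X : heart T) : heart_lift C (sval X) <-> C X.
Proof.
case: X => X hX; split=> [[hX']|CX]; last by exists hX.
by rewrite /hobj (Prop_irrelevance hX' hX).
Qed.

Lemma ICE_ice_data (C : int -> set (heart T)) :
  ICE_seq C -> ice_data T (fun k => heart_lift (C k)).
Proof.
move=> IC; split.
- by move=> k X [].
- move=> k X X0; have [[[C0 _ _] _ _ _] _ _] := IC k.
  by exists (heart_zero T X0); apply: C0.
- move=> k X Y XY [hX CX]; have [[[_ _ Ci] _ _ _] _ _] := IC k.
  have hY := heart_iso XY hX; exists hY.
  by apply: (Ci (hobj hX) (hobj hY)).
- move=> k X Y Z [f [g [h d]]] [hX CX] [hZ CZ]; have [[_ Ce _ _] _ _] := IC k.
  have hY : heart_set T Y by apply: (heart_ext _ hX hZ); exists f, g, h.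
  exists hY; apply: (Ce (hobj hX) (hobj hY) (hobj hZ) f g) => //.
  exact: (@dist_short_exact D T (hobj hX) (hobj hY) (hobj hZ) f g h).
- move=> k X [hX CX]; have [_ Ca _] := IC k.
  by exists hX; have [] := Ca _ CX.
move=> m A B K I Q k p r j c s dk dj hK hI hQ [hA CA] [hB CB].
have [[Cs Ce Cim Cco] Ca [_ _ Cq]] := IC m.
split.
  exists hK; have [_ kB] := Ca _ CB.
  apply: (kB (hobj hA) (j \oc p) CA (hobj hK) k).
  exact: (@heart_factor_kernel D T (hobj hA) (hobj hB) (hobj hK) (hobj hI)
    (hobj hQ) k p r j c s).
(* The torsion class is closed under quotients only inside [alpha (C m)], so [Q] has to be placed
   there first. *)
have aQ : alpha (C m) (hobj hQ).
  by apply: (@alpha_cokernel (C m) (hobj hA) (hobj hB) (hobj hI) (hobj hQ)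
    (hobj hK) k p r j c s) => //; apply: Ca.
exists hQ.
apply: (Cq (exist _ (hobj hB) (Ca _ CB)) (exist _ (hobj hQ) aQ) c) => //.
move=> [[Z hZ] aZ] u v; exact: (dist_epi dj hI.1 hZ.2).
Qed.

End ICEHeart.

(** * The ICE sequence of a homology-determined preaisle *)

Section Mu.
Variables (D : triCat) (T : tStructure D) (U : set D).
Hypotheses (Uhd : homology_determined T U) (Ue : tri_closed U) (Us : susp_closed U).
Implicit Types (X Y Z V W M : D) (m n k : int).

Let Ui : iso_closed U.
Proof. by have [[]] := Uhd. Qed.

Lemma hd_Hk k X : U X -> U (shift (HkD T k X) (- k)).
Proof.
have [_ hd] := Uhd; move=> /hd /(_ k) [Y UY]; rewrite isomorphic_shiftE => XY.
exact: Ui (isomorphic_sym XY) UY.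
Qed.

Lemma muE k (X : heart T) : mu T U k X <-> U (shift (sval X) (- k)).
Proof.
split=> [[Y UY XY]|UX].
  apply: Ui (hd_Hk k UY); apply: isomorphic_shift; exact: isomorphic_sym XY.
exists (shift (sval X) (- k)) => //.
exact: (isomorphic_sym (Hk_heart_shift k (svalP X))).
Qed.

(** After the shift, the triangle is a truncation triangle of [Z] with [Q] in degree [k] and [K] in
    degree [k - 1], so these are cohomology objects of a member of [U]. *)
Lemma hd_two_step k (K Q : heart T) Z : tri (susp (sval K)) Z (sval Q) ->
  U (shift Z (- k)) -> mu T U k Q /\ mu T U (k - 1) K.
Proof.
move=> d UZ; have d' := proj1 (tri_shift _ _ _ (- k)) d.
have kE : - (k - 1) = - k + 1 by lia.
have X'E : isomorphic (shift (susp (sval K)) (- k)) (shift (sval K) (- (k - 1))).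
  by rewrite kE; apply: shift_susp.
have aX' : tle T (k - 1) (shift (susp (sval K)) (- k)).
  exact: tle_iso (isomorphic_sym X'E) (heart_shift_tle _ (svalP K)).
split; apply/muE; apply: Ui (hd_Hk _ UZ); apply: isomorphic_shift.
  exact: Hk_top d' aX' (svalP Q).
apply: isomorphic_trans (Hk_truncation (n := k - 1) _ d' _) _; first by [].
  by rewrite subrK; apply: heart_shift_tge; apply: svalP.
apply: isomorphic_trans (Hk_iso _ _ X'E) _.
by apply: Hk_heart_shift; apply: svalP.
Qed.

Lemma mu_tri k (X Y Z : heart T) : tri (sval X) (sval Y) (sval Z) ->
  mu T U k X -> mu T U k Z -> mu T U k Y.
Proof. by move=> /(tri_shift _ _ _ (- k)) d; rewrite !muE; apply: Ue d. Qed.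

Lemma mu_iso k (X Y : heart T) : isomorphic X Y -> mu T U k X -> mu T U k Y.
Proof.
move=> XY; rewrite !muE; apply: Ui; apply: isomorphic_shift; exact: XY.
Qed.

Lemma mu_subcat k : subcat (mu T U k).
Proof.
split.
- move=> X X0; apply/muE; have [[U0 _ _] _] := Uhd; apply: U0.
  by apply/is_zero_shift; apply: X0.
- move=> X Y S XYS; apply: mu_tri.
  exact: (@biproduct_tri D (sval X) (sval Y) (sval S) XYS).
- exact: mu_iso.
Qed.

(** The shifted cone of [j \oc p] lies in [U], which yields [Q] and, one degree lower, [K]. The
    latter says that [susp K] shifted by [- k] is in [U], and [I] is an extension of [susp K] by
    [A]. *)
Lemma mu_factor k (A B K I Q : heart T) (k' : hom K A) (p : hom A I) r
    (j : hom I B) (c : hom B Q) s :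
  @dist D (sval K) (sval A) (sval I) k' p r ->
  @dist D (sval I) (sval B) (sval Q) j c s ->
  mu T U k A -> mu T U k B -> mu T U k I /\ mu T U k Q.
Proof.
move=> dk dj /muE UA /muE UB.
have [Z [g [h dZ]]] := dist_ex (j \oc p : @hom D (sval A) (sval B)).
have dZ' := cone_filtration dk dj dZ.
have shk W : isomorphic (shift (susp W) (- k)) (susp (shift W (- k))).
  by apply: isomorphic_trans (shift_susp _ _) (isomorphic_sym (susp_shift _ _)).
have UZ : U (shift Z (- k)).
  have d : tri (sval B) Z (susp (sval A)).
    by apply: (proj1 (tri_rot _ _ _)); exists (j \oc p), g, h.
  apply: (Ue (proj1 (tri_shift _ _ _ (- k)) d) UB).
  by apply: Ui (isomorphic_sym (shk _)) _; apply: Us.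
have [UQ /muE UK] := hd_two_step dZ' UZ; split=> //; apply/muE.
have d : tri (sval A) (sval I) (susp (sval K)).
  by apply: (proj1 (tri_rot _ _ _)); exists k', p, r.
apply: (Ue (proj1 (tri_shift _ _ _ (- k)) d) UA); apply: Ui UK.
have -> : - (k - 1) = - k + 1 by lia.
exact/isomorphic_sym/shift_susp.
Qed.

Lemma mu_ICE_closed k : ICE_closed (mu T U k).
Proof.
split; first exact: mu_subcat.
- move=> X Y Z f g /short_exact_dist[h d]; apply: mu_tri; by exists f, g, h.
- move=> X Y f UX UY V v [Z [c [cf vc]]].
  have [K [I [Q [k' [p [r [j [c' [s [dk dj fE]]]]]]]]]] := heart_factorP f.
  have [UI _] := mu_factor dk dj UX UY.
  rewrite fE in cf.
  have [a ai ac] := cokernel_iso (heart_factor_cokernel dk dj) cf.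
  have jk : is_kernel c j.
    by rewrite -ac; apply: is_kernel_postcomp ai (dist_short_exact dj).1.
  have [b bi _] := kernel_iso jk vc.
  by apply: mu_iso UI; exists b.
move=> X Y f UX UY Z c cf.
have [K [I [Q [k' [p [r [j [c' [s [dk dj fE]]]]]]]]]] := heart_factorP f.
have [_ UQ] := mu_factor dk dj UX UY.
rewrite fE in cf; have [a ai _] := cokernel_iso (heart_factor_cokernel dk dj) cf.
by apply: mu_iso UQ; exists a.
Qed.

(** Shifted by [- (k + 1)], the object [susp B] becomes [B] shifted by [- k]. Hence the cone of
    [f : B -> A] enters [U] with its cokernel in degree [k + 1] and its kernel in degree [k]. *)
Lemma mu_alpha k : mu T U (k + 1) `<=` alpha (mu T U k).
Proof.
move=> A /muE UA; split.
  apply/muE; apply: Ui (Us UA).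
  apply: isomorphic_trans (susp_shift _ _) _.
  have -> : - (k + 1) + 1 = - k by lia.
  exact: isomorphic_refl.
move=> B f /muE UB K0 k0 kk0.
have [K [I [Q [k' [p [r [j [c' [s [dk dj fE]]]]]]]]]] := heart_factorP f.
rewrite fE in kk0; have [b bi _] := kernel_iso (heart_factor_kernel dk dj) kk0.
apply: (@mu_iso k K); first by exists b.
have [Z [g [h dZ]]] := dist_ex (j \oc p : @hom D (sval B) (sval A)).
have [|_] := hd_two_step (k := k + 1) (cone_filtration dk dj dZ) _; last by rewrite addrK.
have d : tri (sval A) Z (susp (sval B)).
  by apply: (proj1 (tri_rot _ _ _)); exists (j \oc p), g, h.
apply: (Ue (proj1 (tri_shift _ _ _ (- (k + 1))) d) UA); apply: Ui UB.
have -> : - k = - (k + 1) + 1 by lia.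
exact/isomorphic_sym/shift_susp.
Qed.

(* An epimorphism in alpha C(k) is an epimorphism in the heart, because its
   cokernel in the heart already lies in alpha C(k). *)
Lemma alpha_epi (C : set (heart T)) (x y : fullsub (alpha C)) (f : hom x y)
    (K I Q : heart T) (k : hom K (sval x)) (p : hom (sval x) I) r (j : hom I (sval y))
    (c : hom (sval y) Q) s : ICE_closed C ->
  @dist D (sval K) (sval (sval x)) (sval I) k p r ->
  @dist D (sval I) (sval (sval y)) (sval Q) j c s ->
  f = j \oc p -> epi f -> isomorphic I (sval y).
Proof.
move=> IC dk dj fE fe.
have aQ : alpha C Q := alpha_cokernel dk dj IC (svalP x).1 (svalP y).
have [cf _] := heart_factor_cokernel dk dj.
have c0 : c = 0.
  apply: (fe (exist _ Q aQ)); rewrite fE.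
  by transitivity (0 : @hom (heart T) (sval x) Q); [exact: cf|apply/esym; exact: comp0m].
have Q0 : is_zero Q.
  by apply: (cokernel_epi (dist_short_exact dj).2); rewrite c0 !compm0.
by exists j; apply: (dist_zero_iso dj).
Qed.

(** Exactness inside [alpha] is turned into triangles: [alpha_epi] handles the epimorphisms and
    [alpha_kernel] puts the kernel from the heart back into [alpha]. *)
Lemma mu_torsion k :
  torsion_class (@within (heart T) (alpha (mu T U k)) (mu T U (k + 1))).
Proof.
have [U0 Ub _] := mu_subcat (k + 1).
have IC := mu_ICE_closed k.
split; first split.
- by move=> X X0; apply: U0; apply: X0.
- by move=> X Y S XYS; apply: (Ub (sval X) (sval Y) (sval S) XYS).
- by move=> X Y XY; apply: mu_iso; apply: XY.
- move=> x y z f g [kf cg] Ux Uz.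
  have [K [I [Q [k' [p [r [j [c [s [dk dj gE]]]]]]]]]] :=
    @heart_factorP D T (sval y) (sval z) g.
  have Iz := alpha_epi IC dk dj gE (cokernel_epi cg).
  have kk := heart_factor_kernel dk dj; rewrite -gE in kk.
  have aK : alpha (mu T U k) K := alpha_kernel (svalP y) (svalP z) kk.
  have kk' : @is_kernel (fullsub (alpha (mu T U k))) y z g (exist _ K aK) k'.
    by split; [exact: kk.1|move=> [W aW]; exact: (kk.2 W)].
  have [a ai _] := kernel_iso kf kk'.
  apply: (@mu_tri (k + 1) (sval x) (sval y) (sval z)) => //.
  apply: (tri_iso (X := sval K) (Y := sval (sval y)) (Z := sval I)).
  + by apply: isomorphic_sym; exists a.
  + exact: isomorphic_refl.
  + exact: Iz.
  + by exists k', p, r.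
move=> x y f fe Ux.
have [K [I [Q [k' [p [r [j [c [s [dk dj fE]]]]]]]]]] :=
  @heart_factorP D T (sval x) (sval y) f.
have Iy := alpha_epi IC dk dj fE fe.
have kk := heart_factor_kernel dk dj; rewrite -fE in kk.
have [_ ky] := svalP y; have [Ux' _] := svalP x.
(* Degree [k] is enough for the kernel, because the quotient is an extension of [susp K] by the
   source. *)
have /muE UK := ky _ _ Ux' _ _ kk.
apply: (@mu_iso _ I _ Iy); move/muE: Ux => Ux; apply/muE.
have d : tri (sval (sval x)) (sval I) (susp (sval K)).
  by apply: (proj1 (tri_rot _ _ _)); exists k', p, r.
apply: (Ue (proj1 (tri_shift _ _ _ (- (k + 1))) d) Ux); apply: Ui UK.
have -> : - k = - (k + 1) + 1 by lia.
exact/isomorphic_sym/shift_susp.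
Qed.

Lemma mu_ICE_seq : ICE_seq (mu T U).
Proof. by move=> k; split; [exact: mu_ICE_closed|exact: mu_alpha|exact: mu_torsion]. Qed.

(** Cover the object in [D] by [M] and replace [M] by its cohomology [A] in degree 0: the cover
    restricted to [L] factors through [A], and morphisms from the heart to [M] lift to [L]. *)
Lemma mu_contrav_finite : contrav_finite U -> contrav_finite_seq (mu T U).
Proof.
move=> cU k X.
have [M [f [UM fP]]] := contrav_finite_shift (- k) Ui cU (sval X).
have [L [V [P [[l [v [t dl]]] [aL bV] [i [q [w di]]] [aP hA]]]]] := HkP T 0 M.
have UA : mu T U k (hobj hA).
  apply/muE; apply: Ui (hd_Hk k UM); apply: isomorphic_shift.
  apply: isomorphic_trans (Hk_shift _ _ _ _) _; rewrite addNr; exact: isomorphic_refl.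
have [|a aE] := dist_weak_cokernel (u := f \oc l) di.
  by apply: (@truncation_orth _ T (-1)) aP _; have [] := svalP X.
exists (hobj hA), a; split=> // B g /muE UB.
have [b bE] := fP (sval B) g UB.
have [|b' b'E] := dist_weak_kernel (u := b) dl.
  by apply: (@truncation_orth _ T 0) bV; have [] := svalP B.
exists (q \oc b'); rewrite bE b'E compmA aE; exact: (esym (@compmA D _ _ _ _ a q b')).
Qed.

Lemma mu_full : two_sided_bounded T U -> full_seq (mu T U).
Proof.
move=> [m [n [mn mU Un]]]; exists m, (n + 1); split; first lia.
  apply/seteqP; split=> // X _; apply/muE/mU; apply: heart_shift_tle; exact: svalP.
apply/seteqP; split=> X; last by have [U0 _ _] := mu_subcat (n + 1); apply: U0.
move=> /muE/Un aX.
suff: @is_zero D (sval X) by [].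
apply/(is_zero_shift _ (- (n + 1))).
apply: (@tle_tge_zero _ T n (n + 1)) aX _; first lia.
by apply: heart_shift_tge; apply: svalP.
Qed.

End Mu.

(** * The bijections, and the algebraic case *)

Section Main.
Variables (D : triCat) (T : tStructure D).
Hypothesis bT : bounded T.
Implicit Types (X Y Z A : D) (m n k : int) (U P : set D).

Lemma shift_setE U k X : iso_closed U -> shift_set U k X <-> U (shift X (- k)).
Proof.
move=> Ui; split=> [[Y UY]|UX].
  by rewrite isomorphic_shiftE => XY; apply: Ui (isomorphic_sym XY) UY.
by exists (shift X (- k)) => //; apply/isomorphic_sym/shiftNK.
Qed.

Lemma thetaE (C : int -> set (heart T)) :
  theta T C = cohom_in T (fun k => heart_lift (C k)).
Proof.
by apply/seteqP; split=> X UX k; have := UX k; rewrite -heart_liftE.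
Qed.

Lemma theta_homology_determined (C : int -> set (heart T)) :
  ICE_seq C -> homology_determined T (theta T C).
Proof.
move=> /ICE_ice_data iP; rewrite thetaE; split; first exact: cohom_in_subcat.
have E k X := shift_setE k X (cohom_in_iso iP).
move=> X; split=> [UX k|UX k].
  by apply/E; apply/(cohom_in_heart iP); [apply: svalP|apply: UX].
apply/(cohom_in_heart iP); first exact: Hk_heart.
by apply/E; apply: UX.
Qed.

(** An approximation by the heart is composed with one inside the heart. *)
Lemma heart_lift_contrav_finite (C : set (heart T)) :
  contrav_finite (heart_set T) -> contrav_finite C -> contrav_finite (heart_lift C).
Proof.
move=> cH cC X; have [Y [f [hY fP]]] := cH X.
have [Z [g [CZ gP]]] := cC (hobj hY).
exists (sval Z), (f \oc g); split; first exact/heart_liftE.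
move=> W h [hW CW]; have [h' h'E] := fP W h hW.
have [h'' h''E] := gP (hobj hW) h' CW.
by exists h''; rewrite h'E h''E; exact: (@compmA D _ _ _ _ f g h'').
Qed.

Lemma theta_bounded_hd_aisle : contrav_finite (heart_set T) ->
  {homo theta T : C / cf_full_ICE_seqs T C >-> bounded_hd_aisles T C}.
Proof.
move=> cH C [IC cC [m [n [mn Cm Cn]]]].
have iP := ICE_ice_data IC.
have Pm X : heart_set T X -> heart_lift (C m) X by move=> hX; exists hX; rewrite Cm.
have Pn : heart_lift (C n) `<=` @is_zero D by move=> X [hX]; rewrite Cn.
have hd := theta_homology_determined IC; split=> //; rewrite thetaE.
  apply: (cohom_in_aisle iP bT Pm Pn) => k.
  exact: heart_lift_contrav_finite.
have [mU Un] := cohom_in_full iP bT Pm Pn.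
by exists m, n; split=> // X /Un; apply: tle_le; lia.
Qed.

Lemma mu_cf_full_ICE_seq U :
  bounded_hd_aisles T U -> cf_full_ICE_seqs T (mu T U).
Proof.
move=> [[T' <-] b hd].
have Ue := @aisle_tri_closed D T'; have Us := @aisle_susp D T'.
split; first exact: mu_ICE_seq.
  apply: mu_contrav_finite => //.
  suff -> : aisle T' = tle T' 0 by apply: tle_contrav_finite.
  by apply/seteqP; split=> X; rewrite tleE.
exact: mu_full.
Qed.

Lemma thetaK (C : int -> set (heart T)) : ICE_seq C -> mu T (theta T C) = C.
Proof.
move=> IC; apply/funext => k; have iP := ICE_ice_data IC.
have [[[_ _ Ci] _ _ _] _ _] := IC k.
apply/seteqP; split=> A.
  by move=> [X UX AX]; apply: Ci (isomorphic_sym AX) (UX k).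
move=> CA; exists (shift (sval A) (- k)).
  by rewrite thetaE; apply/(cohom_in_heart iP); [apply: svalP|apply/heart_liftE].
exact: (isomorphic_sym (Hk_heart_shift k (svalP A))).
Qed.

Lemma muK U : homology_determined T U -> theta T (mu T U) = U.
Proof.
move=> [[_ _ Ui] hd]; apply/seteqP; split=> X UX; last first.
  by move=> k; exists X => //; apply: isomorphic_refl.
apply/hd => k; have [Y UY XY] := UX k.
have [Z UZ YZ] := (proj1 (hd Y) UY) k; exists Z => //.
exact: isomorphic_trans (XY : @isomorphic D _ _) YZ.
Qed.

(** The top cohomology is peeled off repeatedly; [N] bounds the number of degrees left. *)
Lemma bounded_filtration P m n X : tri_closed P -> iso_closed P ->
  (forall X, is_zero X -> P X) ->
  (forall k A, (m <= k <= n)%R -> heart_set T A -> P (shift A (- k))) ->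
  tle T n X -> tge T m X -> P X.
Proof.
move=> Pe Pi P0 PA; have [N nE] : exists N : nat, (n < m + N%:Z)%R.
  by exists (absz (n + 1 - m)%R); lia.
elim: N n X nE PA => [|N IH] n X nE PA aX bX.
  by apply: P0; apply: tle_tge_zero aX bX; lia.
have [nm|mn] := Order.TotalTheory.ltP n m.
  by apply: P0; apply: tle_tge_zero aX bX.
have [X' [A [d aX' hA]]] := top_cohomology aX.
have PA' : P (shift A (- n)) by apply: PA => //; lia.
apply: (Pe _ _ _ d) PA'; apply: (IH (n - 1)) => //; first lia.
  by move=> k B kn; apply: PA; lia.
have -> : m = m - 1 + 1 by lia.
apply: tge_tri1 d _ _; first by rewrite subrK.
by apply: tge_le (heart_shift_tge n hA); lia.
Qed.

Lemma finite_length_ind P (X : heart T) : tri_closed P ->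
  (forall X, is_zero X -> P X) -> (forall S : heart T, simple_obj S -> P (sval S)) ->
  finite_length X -> P (sval X).
Proof.
move=> Pe P0 PS; elim=> {X} [X X0|X Y S f g _ PX sS /short_exact_dist [h d]].
  by apply: P0; apply: X0.
by apply: Pe PX (PS S sS); exists f, g, h.
Qed.

(** Every object of the heart is an iterated extension of simples, so a level of [F] containing the
    finitely many simples contains the heart. *)
Lemma algebraic_uniform (F : int -> set D) : algebraic T ->
  (forall n, tri_closed (F n)) -> (forall n, iso_closed (F n)) ->
  (forall n X, is_zero X -> F n X) ->
  (forall m n, (m <= n)%R -> F m `<=` F n) -> (forall X, exists n, F n X) ->
  exists n, heart_set T `<=` F n.
Proof.
move=> [_ [_ fl] [N [s sP]]] Fe Fi F0 Fm Fex.
have [b bP] := choice (fun i => Fex (sval (s i))).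
(* The sum of the absolute values dominates each [b i]. *)
pose n := (\sum_(i < N) absz (b i))%N.
exists n%:Z => X hX; apply: (finite_length_ind (X := hobj hX)) (fl _).
- exact: Fe.
- exact: F0.
- move=> S /sP[i Si]; apply: (Fi n%:Z _ _ (isomorphic_sym (Si : @isomorphic D _ _))).
  apply: Fm (bP i).
  have : (absz (b i) <= n)%N by rewrite /n (bigD1 i) //= leq_addr.
  lia.
Qed.

Lemma algebraic_hd_aisles : algebraic T ->
  bounded_hd_aisles T = hd_bounded_tStructures T.
Proof.
move=> aT; apply/seteqP; split=> [U [[T' T'U] [m [n [mn mU Un]]] hd]|U [T' [T'U bT' hd]]].
  exists T'; split=> //; last by rewrite T'U.
  split; apply/seteqP; split=> // X _.
    have [a aX] := bounded_tle X bT; exists (a - m) => //; apply/tleE.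
    rewrite T'U; apply: mU; apply/tle_shift; by rewrite subrK.
  have [a bX] := bounded_tge X bT; exists (a - n) => //; apply/tgeE/coaisle_perp => W.
  rewrite T'U => /Un aW; apply: (@tle_tge_hom0 _ T n (n + 1)) aW _; first lia.
  by apply/tge_shift; apply: tge_le bX; lia.
split; [by exists T'| |by rewrite -T'U].
have [N hN] : exists N, heart_set T `<=` tle T' N.
  apply: (algebraic_uniform aT) => [n|n|n|m n|X].
  - exact: tle_ext.
  - exact: tle_iso.
  - exact: tle_zero.
  - by move=> mn X; apply: tle_le.
  - exact: bounded_tle.
have [M hM] : exists M, heart_set T `<=` tge T' (- M).
  (* The index is negated so that the family increases with [n]. *)
  apply: (@algebraic_uniform (fun n => tge T' (- n)) aT) => [n|n|n|m n|X].
  - exact: tge_ext.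
  - exact: tge_iso.
  - exact: tge_zero.
  - by move=> mn X; apply: tge_le; lia.
  - by have [n bX] := bounded_tge X bT'; exists (- n); rewrite opprK.
have aE : aisle T' = tle T' 0 by apply/seteqP; split=> X; rewrite tleE.
(* Such an object is filtered by [A[-k]] with [A] in the heart of [T] and [k <= - N]; each layer
   lies in [tle T' 0] by the choice of [N]. *)
have mU : tle T (- N) `<=` U.
  move=> X aX; rewrite -T'U aE; have [b bX] := bounded_tge X bT.
  apply: (bounded_filtration (m := b) (n := - N)) => //.
  - exact: tle_ext.
  - exact: tle_iso.
  - exact: tle_zero.
  by move=> k A kN /hN aA; apply/tle_shift; apply: tle_le aA; lia.
(* Dually, [tge T (M + 1)] lies in [tge T' 1], so it is orthogonal to [U]. *)
have Un : U `<=` tle T M.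
  rewrite -T'U aE => X aX; apply: tle_orth => Y bY.
  suff: tge T' 1 Y by apply: tle_tge_hom0 aX.
  have [a aY] := bounded_tle Y bT.
  apply: (bounded_filtration (m := M + 1) (n := a)) => //.
  - exact: tge_ext.
  - exact: tge_iso.
  - exact: tge_zero.
  by move=> k A kN /hM aA; apply/tge_shift; apply: tge_le aA; lia.
exists (- N), ((absz N)%:Z + (absz M)%:Z); split=> //; first lia.
by move=> X /Un; apply: tle_le; lia.
Qed.

End Main.

Theorem theorem5p5 (D : triCat) (T : tStructure D) :
  bounded T -> contrav_finite (heart_set T) ->
  [/\ set_bij (cf_full_ICE_seqs T) (bounded_hd_aisles T) (theta T),
      set_bij (bounded_hd_aisles T) (cf_full_ICE_seqs T) (mu T),
      {in cf_full_ICE_seqs T, cancel (theta T) (mu T)}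
    & {in bounded_hd_aisles T, cancel (mu T) (theta T)}] /\
  (algebraic T -> bounded_hd_aisles T = hd_bounded_tStructures T).
Proof.
move=> bT cH.
have tm := theta_bounded_hd_aisle bT cH.
have mm := @mu_cf_full_ICE_seq D T.
have tK : {in cf_full_ICE_seqs T, cancel (theta T) (mu T)}.
  by move=> C; rewrite in_setE => -[IC _ _]; apply: thetaK.
have mK : {in bounded_hd_aisles T, cancel (mu T) (theta T)}.
  by move=> U; rewrite in_setE => -[_ _ hd]; apply: muK.
split; last exact: algebraic_hd_aisles.
split=> //; split.
- exact: tm.
- exact: can_in_inj tK.
- move=> U hU; exists (mu T U); first exact: mm.
  by apply: mK; rewrite in_setE.
- exact: mm.
- exact: can_in_inj mK.
- move=> C hC; exists (theta T C); first exact: tm.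
  by apply: tK; rewrite in_setE.
Qed.
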